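(* Let $\alpha \in (0,1)$ and $A \in L(H)$. Define $f : \{z\in\mathbb{C} : |z|>1\} \to \mathbb{C}$, $f(z) = z(1-z^{-1})^\alpha$, and for $\rho>1$ let $f_\rho := f|_{S_\rho}$ with range $\operatorname{ran} f_\rho$. Then for every $\rho>1$ the operator $\tau(1-\tau^{-1})^\alpha - A$ is invertible in $\ell_{2,\rho}(\mathbb{Z};H)$ if and only if $\operatorname{ran} f_\rho \cap \sigma(A) = \emptyset$. Moreover, there is $\rho>1$ such that for all $\mu>\rho$ one has $\operatorname{ran} f_\mu \cap \sigma(A) = \emptyset$, that is, $\{z(1-z^{-1})^\alpha : |z|>\rho\}$ is contained in the resolvent set of $A$.
   Context: $H$ is a complex separable Hilbert space, $L(H)$ the bounded linear operators on $H$, $\sigma(A)$ the spectrum of $A$. For $\rho>0$, $S_\rho=\{z\in\mathbb{C}:|z|=\rho\}$ and $\ell_{2,\rho}(\mathbb{Z};H)=\{x\in H^{\mathbb{Z}} : \sum_{k\in\mathbb{Z}}\|x_k\|_H^2\rho^{-2k}<\infty\}$, a Hilbert space with norm $(\sum_k\|x_k\|_H^2\rho^{-2k})^{1/2}$. $\tau$ is the shift $(\tau x)_k=x_{k+1}$, a bounded invertible operator on $\ell_{2,\rho}(\mathbb{Z};H)$. The operator $A\in L(H)$ also denotes the bounded operator $(x_k)_k\mapsto(Ax_k)_k$ on $\ell_{2,\rho}(\mathbb{Z};H)$. ''Invertible in $\ell_{2,\rho}(\mathbb{Z};H)$'' means bijective with bounded inverse. For $|w|<1$ and $\alpha\in\mathbb{C}$,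 $(1+w)^\alpha:=\sum_{k=0}^\infty\binom{\alpha}{k}w^k$, where $\binom{\alpha}{0}=1$, $\binom{\alpha}{k}=\frac{\alpha(\alpha-1)\cdots(\alpha-k+1)}{k!}$. For $\rho>1$, the operator $(1-\tau^{-1})^\alpha$ on $\ell_{2,\rho}(\mathbb{Z};H)$ is defined as $\mathcal{Z}_\rho^*\,(1-z^{-1})^\alpha\,\mathcal{Z}_\rho$ (multiplication by $(1-z^{-1})^\alpha$ in the middle), where $\mathcal{Z}_\rho:\ell_{2,\rho}(\mathbb{Z};H)\to L_2(S_\rho;H)$ is the unitary transform $x\mapsto(z\mapsto\sum_k x_kz^{-k})$ (the series converging in $L_2(S_\rho;H)$, whose norm is $(\frac1{2\pi}\int_{S_\rho}\|f(z)\|_H^2\frac{|dz|}{|z|})^{1/2}$); equivalently, $((1-\tau^{-1})^\alpha u)_n=\sum_{k=0}^\infty(-1)^k\binom{\alpha}{k}u_{n-k}$ for $n\in\mathbb{Z}$. *)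

(* Defs.v *)
From HB Require Import structures.
From mathcomp Require Import all_boot all_order all_algebra complex.
From mathcomp Require Import sesquilinear all_classical all_reals all_analysis.

Set Implicit Arguments.
Unset Strict Implicit.
Unset Printing Implicit Defensive.

Import Order.TTheory GRing.Theory Num.Theory.
Import numFieldNormedType.Exports.

Local Open Scope classical_set_scope.
Local Open Scope ring_scope.
Local Open Scope complex_scope.

(* The norm of a normed module over R[i] takes values in R[i] (with zero
   imaginary part); [nrm] is the same norm as a real number. *)
Definition nrm (R : realType) (H : normedModType R[i]) (x : H) : R :=
  complex.Re `|x|.

(* A complete normed module over R[i] with such a form is a complex Hilbert
   space. The form is linear in its first argument. *)
Definition hilbert_form (R : realType) (H : normedModType R[i])
    (form : {dot H for Num.conj}) : Prop :=
  forall x : H, `|x| ^+ 2 = form x x.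

Definition separable_space (T : topologicalType) : Prop :=
  exists2 D : set T, countable D & dense D.

Definition bounded_operator (R : realType) (H : normedModType R[i])
    (A : H -> H) : Prop :=
  exists M : R, forall x : H, nrm (A x) <= M * nrm x.

(* The restriction of T to the space D, normed by N, maps D to D bijectively
   and its inverse S is bounded. *)
Definition invertible_on (R : realType) (V : Type) (D : set V) (N : V -> R)
    (T : V -> V) : Prop :=
  (forall x, D x -> D (T x)) /\
  exists S : V -> V,
    [/\ forall y, D y -> D (S y),
        forall x, D x -> S (T x) = x,
        forall y, D y -> T (S y) = y
      & exists M : R, forall y, D y -> N (S y) <= M * N y].

Definition resolvent_set (R : realType) (H : normedModType R[i])
    (A : H -> H) : set R[i] :=
  [set l | invertible_on [set: H] (@nrm R H) (fun x => l *: x - A x)].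

Definition spectrum (R : realType) (H : normedModType R[i])
    (A : H -> H) : set R[i] := ~` resolvent_set A.

Definition circle (R : realType) (rho : R) : set R[i] :=
  [set z | `|z| = rho%:C].

Definition binomC (R : realType) (a : R[i]) (k : nat) : R[i] :=
  (\prod_(i < k) (a - i%:R)) / k`!%:R.

(* (1 + w) ^ a, meaningful for |w| < 1. *)
Definition pow1p (R : realType) (a w : R[i]) : R[i] :=
  lim (series (fun k => binomC a k * w ^+ k : (R[i])^o) @ \oo).

Definition symb (R : realType) (a z : R[i]) : R[i] := z * pow1p a (- z^-1).

Definition ell2_sqnorm (R : realType) (H : normedModType R[i]) (rho : R)
    (x : int -> H) : \bar R :=
  (\esum_(k in [set: int]) (nrm (x k) ^+ 2 * rho ^ (- (2 * k)))%:E)%E.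

Definition ell2 (R : realType) (H : normedModType R[i]) (rho : R) :
    set (int -> H) :=
  [set x | (ell2_sqnorm rho x < +oo)%E].

Definition ell2_norm (R : realType) (H : normedModType R[i]) (rho : R)
    (x : int -> H) : R := Num.sqrt (fine (ell2_sqnorm rho x)).

Definition tau (H : Type) (x : int -> H) : int -> H := fun k => x (k + 1).

Definition circle_point (R : realType) (rho t : R) : R[i] :=
  (rho * cos t) +i* (rho * sin t).

(* L_2(S_rho; H) is described by representatives F, defined on the whole of
   R[i] but looked at on the circle only. With z = rho * e^(it), the measure
   |dz| / |z| is dt. As H is separable, Borel measurability of F is the same as
   strong measurability. *)
Definition L2_sqnorm (R : realType) (H : normedModType R[i]) (rho : R)
    (F : R[i] -> H) : \bar R :=
  (((2 * pi)^-1)%:E * \int[lebesgue_measure]_(t in `[0%R, (2 * pi)%R])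
     (nrm (F (circle_point rho t)) ^+ 2)%:E)%E.

Definition L2_circle (R : realType) (H : normedModType R[i]) (rho : R) :
    set (R[i] -> H) :=
  [set F | measurable_fun `[0%R, (2 * pi)%R]
             (fun t : R =>
                F (circle_point rho t) : g_sigma_algebraType (@open H))
           /\ (L2_sqnorm rho F < +oo)%E].

(* The partial sum of x_k z^(-k) over -n <= k <= n. *)
Definition Zpartial (R : realType) (H : normedModType R[i]) (x : int -> H)
    (n : nat) (z : R[i]) : H :=
  \sum_(j < (2 * n).+1) (let k : int := j%:Z - n%:Z in z ^ (- k) *: x k).

Definition is_Ztransform (R : realType) (H : normedModType R[i]) (rho : R)
    (x : int -> H) (F : R[i] -> H) : Prop :=
  L2_circle rho F /\
  (fun n => L2_sqnorm rho (fun z => F z - Zpartial x n z)) @ \oo --> 0%E.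

(* A representative of the class of the transform of x in L_2(S_rho; H). *)
Definition Ztransform (R : realType) (H : normedModType R[i]) (rho : R)
    (x : int -> H) : R[i] -> H :=
  xget (fun=> 0) [set F | is_Ztransform rho x F].

(* The adjoint of the unitary transform is its inverse. *)
Definition Zadjoint (R : realType) (H : normedModType R[i]) (rho : R)
    (F : R[i] -> H) : int -> H :=
  xget (fun=> 0) [set x | ell2 rho x /\ is_Ztransform rho x F].

(* (1 - tau^-1) ^ a on the weighted sequence space. *)
Definition frac_diff (R : realType) (H : normedModType R[i]) (rho : R)
    (a : R[i]) (u : int -> H) : int -> H :=
  Zadjoint rho (fun z => pow1p a (- z^-1) *: Ztransform rho u z).

(* Main.v *)
Require Import Defs.
From HB Require Import structures.
From mathcomp Require Import all_boot all_order all_algebra complex.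
From mathcomp Require Import sesquilinear all_classical all_reals all_analysis.
From mathcomp Require Import measurable_realfun.
From mathcomp Require Import ring lra zify.

Set Implicit Arguments.
Unset Strict Implicit.
Unset Printing Implicit Defensive.

Import Order.TTheory GRing.Theory Num.Theory.
Import numFieldNormedType.Exports.

Local Open Scope classical_set_scope.
Local Open Scope ring_scope.
Local Open Scope complex_scope.

(** Write phi(z) = (1 - 1/z)^alpha = sum_j c_j z^(-j). Since 0 < alpha < 1, the
    coefficients satisfy |c_j| <= 1, so that for |z| = rho > 1 the series
    converges geometrically. Let f(z) = z phi(z) and
    T = tau (1 - tau^(-1))^alpha - A.

    First, the fractional difference is the convolution with (c_j)
    ([frac_diff_conv]). The transform is treated as a closed graph ([Zgraph]):
    Parseval's identity makes it isometric on finitely supported sequences, a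
    Riesz-Fischer argument makes it total, and multiplication by a power of z
    is the transform of a shift. Passing to the limit in the partial sums of
    phi gives the transform of a convolution, and T becomes multiplication by
    the operators f(z) - A.

    If T is invertible, let |z| = rho and let u_k = chi_k z^k h, where chi is a
    slowly varying window with chi_0 = 1. This u is almost fixed by the
    isometry z^(-1) tau, hence T u is close to the sequence
    chi_k z^k (f(z) - A) h ([approx_eigen], [opT_wave]). The lower bound of T
    then bounds f(z) - A from below. To solve (f(z) - A) g = h up to a small
    error, put x = T^(-1) u. As T^(-1) commutes with z^(-1) tau, the sequence x
    is almost fixed as well, so T x is close to (f(z) - A) x_k at every k, and
    g = x_0 will do because u_0 = h ([resolvent_of_invertible]).

    Conversely, let f(z) - A be invertible for all |z| = rho. By compactness
    the inverses are bounded by one constant ([uniform_lower_bound]).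
    Integrating over the circle gives a lower bound of T
    ([opT_bounded_below]). The range of T is dense: a sequence supported at one
    point is an average over roots of unity w of waves chi_k (rho w)^k h, and
    replacing h by (f(rho w) - A)^(-1) h solves the equation for each wave up to
    a small error ([dense_range]). A bounded operator on a complete space that
    is bounded below and has dense range is invertible
    ([invertible_of_approx]).

    For large |z| one has |phi(z)| >= 1/2, so |f(z)| exceeds the norm of A and
    f(z) lies in the resolvent set by the Neumann series ([symbol_large]). *)

(** * Real-valued norms *)

Section norms.
Variable R : realType.

(** Convertible to [nrm] on the regular module of scalars, but free of casts. *)
Definition cabs (z : R[i]) : R := complex.Re `|z|.

Section normed.
Variable V : normedModType R[i].
Implicit Types (x y : V) (c : R[i]).

Lemma nrmE x : `|x| = (nrm x)%:C.
Proof. by rewrite /nrm RRe_real// normr_real. Qed.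

Lemma nrm_ge0 x : 0 <= nrm x.
Proof. by rewrite -ler0c -nrmE. Qed.

Lemma nrm0 : nrm (0 : V) = 0.
Proof. by rewrite /nrm normr0. Qed.

Lemma nrm_eq0 x : nrm x = 0 -> x = 0.
Proof. by move=> x0; apply/eqP; rewrite -normr_eq0 nrmE x0. Qed.

Lemma nrmN x : nrm (- x) = nrm x.
Proof. by rewrite /nrm normrN. Qed.

Lemma nrm_distC x y : nrm (x - y) = nrm (y - x).
Proof. by rewrite /nrm distrC. Qed.

Lemma nrmD x y : nrm (x + y) <= nrm x + nrm y.
Proof. by rewrite -lecR rmorphD/= -!nrmE ler_normD. Qed.

Lemma nrmB x y : nrm (x - y) <= nrm x + nrm y.
Proof. by rewrite -(nrmN y) nrmD. Qed.

Lemma nrm_distD y x z : nrm (x - z) <= nrm (x - y) + nrm (y - z).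
Proof. by rewrite (le_trans _ (nrmD _ _))// addrA subrK. Qed.

Lemma nrmZ c x : nrm (c *: x) = cabs c * nrm x.
Proof. by apply: complexI; rewrite rmorphM/= -!nrmE normrZ nrmE. Qed.

Lemma nrm_sum (I : Type) (s : seq I) (F : I -> V) :
  nrm (\sum_(i <- s) F i) <= \sum_(i <- s) nrm (F i).
Proof.
elim: s => [|i s IH]; first by rewrite !big_nil nrm0.
by rewrite !big_cons (le_trans (nrmD _ _))// lerD2l.
Qed.

Lemma nrm_cvgP (T : Type) (F : set_system T) (FF : Filter F) (u : T -> V)
    (l : V) :
  u @ F --> l <-> forall e : R, 0 < e -> \forall t \near F, nrm (l - u t) < e.
Proof.
split=> [/cvgrPdist_lt ul e e0|ul].
  have e0' : (0 : R[i]) < e%:C by rewrite ltcR.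
  by apply: filterS (ul _ e0') => t; rewrite nrmE ltcR.
apply/cvgrPdist_lt => e e0.
have eE : e = (complex.Re e)%:C by rewrite RRe_real// gtr0_real.
move: e0; rewrite eE ltcR => e0.
by apply: filterS (ul _ e0) => t; rewrite nrmE ltcR.
Qed.

Lemma nrm_continuous : continuous (@nrm R V).
Proof.
move=> x; apply/cvgrPdist_lt => e e0.
have /nrm_cvgP/(_ _ e0) : (id y @[y --> x]) --> x by [].
apply: filterS => y; apply: le_lt_trans.
rewrite ler_norml; have := nrm_distD y x 0; have := nrm_distD x y 0.
rewrite !subr0 (nrm_distC y x) => h1 h2.
by rewrite lerBlDr h2 andbT lerNl opprB lerBlDr.
Qed.

Lemma nrm_lim_le (T : Type) (F : set_system T) (FF : ProperFilter F)
    (u : T -> V) (l : V) (a : R) :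
  u @ F --> l -> (\forall t \near F, nrm (u t) <= a) -> nrm l <= a.
Proof.
move=> ul ua; have : nrm (u t) @[t --> F] --> nrm l.
  exact: (cvg_comp _ _ ul (@nrm_continuous l)).
by move=> /cvgr_to_le/(_ ua).
Qed.

Lemma nrm_small x : (forall e : R, 0 < e -> nrm x <= e) -> x = 0.
Proof.
move=> xe; apply: nrm_eq0; apply/eqP; rewrite eq_le nrm_ge0 andbT.
by apply/ler_addgt0Pl => e /xe; rewrite addr0.
Qed.

End normed.

Lemma cabsE (z : R[i]) : `|z| = (cabs z)%:C.
Proof. exact: (@nrmE R[i]^o). Qed.

Lemma cabs_ge0 (z : R[i]) : 0 <= cabs z.
Proof. exact: (@nrm_ge0 R[i]^o). Qed.

Lemma cabsM (z w : R[i]) : cabs (z * w) = cabs z * cabs w.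
Proof. by apply: complexI; rewrite rmorphM/= -!cabsE normrM. Qed.

Lemma cabs1 : cabs 1 = 1.
Proof. by rewrite /cabs normr1. Qed.

Lemma cabsV (z : R[i]) : cabs z^-1 = (cabs z)^-1.
Proof. by apply: complexI; rewrite fmorphV/= -!cabsE normfV. Qed.

Lemma cabsX (z : R[i]) n : cabs (z ^+ n) = cabs z ^+ n.
Proof. by apply: complexI; rewrite rmorphXn/= -!cabsE normrX. Qed.

Lemma cabsXz (z : R[i]) (n : int) : cabs (z ^ n) = cabs z ^ n.
Proof.
case: n => n; first exact: cabsX.
by rewrite !NegzE /exprz /= cabsV cabsX.
Qed.

Lemma cabs_real (x : R) : cabs x%:C = `|x|.
Proof.
by apply: complexI; rewrite -cabsE normc_def /= expr0n/= addr0 sqrtr_sqr.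
Qed.

Lemma cabs_dist3 (a b c d : R[i]) :
  cabs (a - d) <= cabs (a - b) + cabs (b - c) + cabs (d - c).
Proof.
have h1 : cabs (a - d) <= cabs (a - b) + cabs (b - d).
  exact: (@nrm_distD R[i]^o).
have h2 : cabs (b - d) <= cabs (b - c) + cabs (c - d).
  exact: (@nrm_distD R[i]^o).
have h3 : cabs (c - d) = cabs (d - c) by exact: (@nrm_distC R[i]^o).
lra.
Qed.

Lemma Re_le_cabs (z : R[i]) : `|complex.Re z| <= cabs z.
Proof.
have := normc_def z; rewrite cabsE => /complexI ->.
by rewrite -sqrtr_sqr ler_wsqrtr// lerDl sqr_ge0.
Qed.

Lemma Im_le_cabs (z : R[i]) : `|complex.Im z| <= cabs z.
Proof.
have := normc_def z; rewrite cabsE => /complexI ->.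
by rewrite -sqrtr_sqr ler_wsqrtr// lerDr sqr_ge0.
Qed.

Lemma cabs_le_ReIm (z : R[i]) : cabs z <= `|complex.Re z| + `|complex.Im z|.
Proof.
have := @nrmD R[i]^o (complex.Re z)%:C ('i%C * (complex.Im z)%:C).
rewrite -[_ + _ in X in X -> _]complexE => /le_trans; apply.
apply: lerD; first by rewrite -[leLHS]/(cabs _) cabs_real.
rewrite -[leLHS]/(cabs _) cabsM cabs_real [X in X * _](_ : _ = 1) ?mul1r//.
by rewrite /cabs normc_def /= expr0n /= add0r expr1n sqrtr1.
Qed.

Definition nrm_cauchy (V : normedModType R[i]) (u : nat -> V) : Prop :=
  forall e : R, 0 < e ->
    exists N, forall n m, (N <= n)%N -> (N <= m)%N -> nrm (u n - u m) < e.

(** Sequential completeness for the real-valued norm; it applies both to the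
    Hilbert space and to the scalars. *)
Definition nrm_complete (V : normedModType R[i]) : Prop :=
  forall u : nat -> V, nrm_cauchy u -> exists l : V, u @ \oo --> l.

Lemma complete_nrm (V : completeNormedModType R[i]) : nrm_complete V.
Proof.
move=> u uC; apply/cvg_ex; apply: cauchy_cvg; apply/cauchy_exP => e e0.
have eE : e = (complex.Re e)%:C by rewrite RRe_real// gtr0_real.
move: (e0); rewrite eE ltcR => e0'.
have [N HN] := uC _ e0'; exists (u N); exists N => // n /= Nn.
by rewrite -ball_normE /= nrmE eE ltcR HN.
Qed.

Lemma real_cauchy_cvg (v : nat -> R) :
  (forall e : R, 0 < e ->
    exists N, forall n m, (N <= n)%N -> (N <= m)%N -> `|v n - v m| < e) ->
  exists l : R, v @ \oo --> l.
Proof.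
move=> vC; apply/cvg_ex; apply: cauchy_cvg; apply/cauchy_exP => e e0.
have [N HN] := vC _ e0; exists (v N); exists N => // n /= Nn.
by rewrite -ball_normE /= HN.
Qed.

Lemma complex_complete : nrm_complete R[i]^o.
Proof.
move=> u uC.
have [a ua] : exists l : R, (fun n => complex.Re (u n)) @ \oo --> l.
  apply: real_cauchy_cvg => e /uC[N HN]; exists N => n m Nn Nm.
  rewrite -raddfB (le_lt_trans (Re_le_cabs _))//; exact: HN.
have [b ub] : exists l : R, (fun n => complex.Im (u n)) @ \oo --> l.
  apply: real_cauchy_cvg => e /uC[N HN]; exists N => n m Nn Nm.
  rewrite -raddfB (le_lt_trans (Im_le_cabs _))//; exact: HN.
exists (a +i* b); apply/nrm_cvgP => e e0.
have e20 : 0 < e / 2 by rewrite divr_gt0.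
move/cvgrPdist_lt : ua => /(_ _ e20) ua.
move/cvgrPdist_lt : ub => /(_ _ e20) ub.
apply: filterS2 ua ub => n an bn.
rewrite -[X in X < _]/(cabs _) (le_lt_trans (cabs_le_ReIm _))//.
rewrite [ltRHS](splitr e); case: (u n) an bn => p q /= an bn.
exact: ltrD.
Qed.

End norms.

(** * Geometric series and the weighted sequence space *)

Lemma cvg_seq_sum (K : numFieldType) (V : normedModType K) (I T : Type)
    (F : set_system T) (FF : Filter F) (s : seq I) (f : I -> T -> V)
    (l : I -> V) :
  (forall i, f i t @[t --> F] --> l i) ->
  \sum_(i <- s) f i t @[t --> F] --> \sum_(i <- s) l i.
Proof.
move=> fl; elim: s => [|i s IH].
  by under eq_fun do rewrite big_nil; rewrite big_nil; exact: cvg_cst.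
by under eq_fun do rewrite big_cons; rewrite big_cons; exact: cvgD.
Qed.

Definition window_seq (n : nat) : seq int :=
  [seq j%:Z - n%:Z | j <- iota 0 (2 * n).+1].

Lemma window_seq_uniq n : uniq (window_seq n).
Proof. by rewrite map_inj_uniq ?iota_uniq// => i j /addIr[]. Qed.

Lemma mem_window_seq n k : (k \in window_seq n) = (`|k| <= n)%N.
Proof.
apply/mapP/idP => [[j]|kn]; first by rewrite mem_iota => jn ->; lia.
by exists (absz (k + n%:Z)); [rewrite mem_iota; lia|lia].
Qed.

Section real_sums.
Variable R : realType.
Implicit Types (r : R).

Lemma geo_sum r n : r < 1 -> \sum_(i < n) r ^+ i = (1 - r ^+ n) / (1 - r).
Proof.
move=> r1; have r1' : 1 - r != 0 by rewrite subr_eq0 eq_sym lt_eqF.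
apply: (mulIf r1'); rewrite divfK//.
elim: n => [|n IH]; first by rewrite big_ord0 expr0 subrr mul0r.
by rewrite big_ord_recr/= mulrDl IH exprS; ring.
Qed.

Lemma geo_sum_le r n : 0 <= r < 1 -> \sum_(i < n) r ^+ i <= (1 - r)^-1.
Proof.
move=> /andP[r0 r1]; rewrite geo_sum// ler_piMl ?invr_ge0 ?subr_ge0 ?(ltW r1)//.
by rewrite gerBl exprn_ge0.
Qed.

Lemma arith_geo_sum_le r n : 0 <= r < 1 ->
  \sum_(i < n) i.+1%:R * r ^+ i <= (1 - r) ^- 2.
Proof.
move=> /andP[r0 r1]; have d0 : 0 < (1 - r) ^+ 2 by rewrite exprn_gt0 ?subr_gt0.
rewrite -div1r ler_pdivlMr//.
have -> : (\sum_(i < n) i.+1%:R * r ^+ i) * (1 - r) ^+ 2 =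
    1 - n.+1%:R * r ^+ n + n%:R * r ^+ n.+1.
  elim: n => [|n IH]; first by rewrite big_ord0 expr0; ring.
  by rewrite big_ord_recr/= mulrDl IH !exprS -!natr1; ring.
have : n%:R * r ^+ n.+1 <= n.+1%:R * r ^+ n.
  rewrite exprS mulrA ler_wpM2r ?exprn_ge0//.
  by rewrite (@le_trans _ _ n%:R) ?ler_nat// ler_piMr ?ler0n ?(ltW r1).
lra.
Qed.

Lemma geo_small r C (e : R) : 0 <= r < 1 -> 0 < e ->
  exists N, forall n, (N <= n)%N -> C * r ^+ n < e.
Proof.
move=> /andP[r0 r1] e0.
have : (fun n => C * r ^+ n) @ \oo --> C * 0.
  by apply: cvgMr; apply: cvg_expr; rewrite ger0_norm.
rewrite mulr0 => /cvgrPdist_lt/(_ _ e0)[N _ HN]; exists N => n /HN/=.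
by rewrite sub0r normrN; apply: le_lt_trans; exact: ler_norm.
Qed.

End real_sums.

Section geometric_series.
Variables (R : realType) (V : normedModType R[i]) (hV : nrm_complete V).

Lemma geo_series_tail (y : nat -> V) (C r : R) n m : 0 <= r < 1 ->
  (forall j, nrm (y j) <= C * r ^+ j) ->
  nrm (series y (n + m)%N - series y n) <= C * r ^+ n / (1 - r).
Proof.
move=> r01 yC; have C0 : 0 <= C.
  by have := yC 0%N; rewrite expr0 mulr1; apply: le_trans; exact: nrm_ge0.
rewrite /series/= (big_cat_nat _ (n := n)) ?leq_addr//= addrAC subrr add0r.
rewrite -{1}[n]add0n big_addn addKn (le_trans (nrm_sum _ _))//.
rewrite big_mkord (@le_trans _ _ (\sum_(i < m) C * r ^+ n * r ^+ i))//.
  by apply: ler_sum => i _; rewrite (le_trans (yC _))// addnC exprD mulrA.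
rewrite -mulr_sumr ler_wpM2l ?geo_sum_le// mulr_ge0// exprn_ge0//.
by case/andP: r01.
Qed.

Lemma geo_series_cvg (y : nat -> V) (C r : R) : 0 <= r < 1 ->
  (forall j, nrm (y j) <= C * r ^+ j) ->
  exists l : V, series y @ \oo --> l.
Proof.
move=> r01 yC; apply: hV => e e0.
have [N HN] := geo_small (C / (1 - r)) r01 e0.
exists N.
suff H n m : (N <= n)%N -> (n <= m)%N -> nrm (series y m - series y n) < e.
  move=> n m Nn Nm; case: (leqP m n) => [mn|/ltnW nm]; first exact: H.
  by rewrite nrm_distC; exact: H.
move=> Nn /subnKC <-; rewrite (le_lt_trans (geo_series_tail _ _ r01 yC))//.
by rewrite mulrAC HN.
Qed.

Lemma geo_series_lim (y : nat -> V) (C r : R) (l : V) n : 0 <= r < 1 ->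
  (forall j, nrm (y j) <= C * r ^+ j) -> series y @ \oo --> l ->
  nrm (l - series y n) <= C * r ^+ n / (1 - r).
Proof.
move=> r01 yC yl; apply: (@nrm_lim_le _ _ _ \oo _
  (fun m => series y m - series y n)).
  by apply: cvgB => //; exact: cvg_cst.
exists n => // m /= nm; rewrite -(subnKC nm); exact: geo_series_tail.
Qed.

End geometric_series.

Section weighted_space.
Variables (R : realType) (rho : R) (rho1 : 1 < rho).

Let rho0 : 0 < rho. Proof. exact: lt_trans rho1. Qed.
Let rhoN0 : rho != 0. Proof. exact: lt0r_neq0. Qed.

Definition wterm (V : normedModType R[i]) (x : int -> V) (k : int) : R :=
  nrm (x k) ^+ 2 * rho ^ (- (2 * k)).

Lemma wtermE (V : normedModType R[i]) (x : int -> V) (k : int) :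
  wterm x k = (nrm (x k) * rho ^ (- k)) ^+ 2.
Proof.
by rewrite /wterm exprMn [(rho ^ _) ^+ 2]exprnP exprz_exp mulNr [k * 2]mulrC.
Qed.

Lemma wterm_ge0 (V : normedModType R[i]) (x : int -> V) (k : int) :
  0 <= wterm x k.
Proof. by rewrite wtermE sqr_ge0. Qed.

(** Membership in the weighted space and a bound a of the norm, in one
    predicate. Finite sums over duplicate-free lists keep the estimates in R and
    make them independent of the order of summation. *)
Definition l2n (V : normedModType R[i]) (x : int -> V) (a : R) : Prop :=
  0 <= a /\
  forall s : seq int, uniq s -> \sum_(k <- s) wterm x k <= a ^+ 2.

Section one.
Variable V : normedModType R[i].
Implicit Types (x y : int -> V) (a b : R).

Lemma l2n_ge0 x a : l2n x a -> 0 <= a. Proof. by case. Qed.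

Lemma esum_uniq_le (f : int -> R) (B : R) : (forall k, 0 <= f k) ->
  (\esum_(k in [set: int]) (f k)%:E <= B%:E)%E <->
  (forall s, uniq s -> \sum_(k <- s) f k <= B).
Proof.
move=> f0; split=> [fB s us|fB].
  rewrite -lee_fin (le_trans _ fB)// esum_ge//; exists [set` s].
    by split=> //; exact: finite_seq.
  by rewrite -fsbig_seq// sumEFin.
apply: ge_ereal_sup => _ [A [finA _] <-].
by rewrite fsbig_finite// sumEFin lee_fin fB// finmap.fset_uniq.
Qed.

Lemma l2nP x a : 0 <= a -> (ell2_sqnorm rho x <= (a ^+ 2)%:E)%E <-> l2n x a.
Proof.
move=> a0; rewrite (esum_uniq_le _ (wterm_ge0 x)).
by split=> [H|[]//]; split.
Qed.

Lemma ell2_sqnorm_ge0 x : (0 <= ell2_sqnorm rho x)%E.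
Proof. by apply: esum_ge0 => k _; rewrite lee_fin wterm_ge0. Qed.

Lemma l2n_ell2 x a : l2n x a -> ell2 rho x.
Proof.
by move=> xa; rewrite /ell2/= (le_lt_trans ((l2nP _ (l2n_ge0 xa)).2 xa)) ?ltry.
Qed.

Lemma l2n_norm x : ell2 rho x -> l2n x (ell2_norm rho x).
Proof.
move=> xl; have x0 := ell2_sqnorm_ge0 x.
apply/l2nP; first exact: sqrtr_ge0.
rewrite /ell2_norm sqr_sqrtr ?fine_ge0// fineK// ge0_fin_numE//.
Qed.

Lemma ell2P x : ell2 rho x <-> exists a, l2n x a.
Proof.
split=> [xl|[a /l2n_ell2//]]; by exists (ell2_norm rho x); exact: l2n_norm.
Qed.

Lemma ell2_norm_le x a : l2n x a -> ell2_norm rho x <= a.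
Proof.
move=> xa; have a0 := l2n_ge0 xa; have x0 := ell2_sqnorm_ge0 x.
rewrite /ell2_norm -[leRHS](ger0_norm a0) -sqrtr_sqr ler_wsqrtr//.
rewrite -lee_fin fineK; first by apply/l2nP.
by rewrite ge0_fin_numE//; exact: l2n_ell2 xa.
Qed.

Lemma ell2_norm_ge0 x : 0 <= ell2_norm rho x.
Proof. exact: sqrtr_ge0. Qed.

Lemma l2n_le x a b : a <= b -> l2n x a -> l2n x b.
Proof.
move=> ab [a0 xa]; have b0 := le_trans a0 ab; split=> // s /xa/le_trans; apply.
by rewrite ler_sqr.
Qed.

Lemma l2n_addgt0 x a :
  0 <= a -> (forall e, 0 < e -> l2n x (a + e)) -> l2n x a.
Proof.
move=> a0 H; split=> // s us; set X := \sum_(k <- s) _.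
have X0 : 0 <= X by apply: sumr_ge0 => k _; exact: wterm_ge0.
rewrite -[X]sqr_sqrtr// ler_sqr ?nnegrE ?sqrtr_ge0//.
apply/ler_addgt0Pr => e e0.
have [ae0 /(_ _ us)] := H _ e0.
rewrite -/X -[X in X <= _ -> _]sqr_sqrtr//.
by rewrite ler_sqr ?nnegrE ?sqrtr_ge0//.
Qed.

Lemma l2n_coord x a k : l2n x a -> nrm (x k) <= a * rho ^ k.
Proof.
move=> [a0 /(_ [:: k] isT)]; rewrite big_seq1 wtermE.
rewrite ler_sqr ?nnegrE ?mulr_ge0 ?nrm_ge0 ?exprz_ge0 ?(ltW rho0)//.
by rewrite -invr_expz ler_pdivrMr// exprz_gt0.
Qed.

Lemma l2n0 a : 0 <= a -> l2n (fun=> 0 : V) a.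
Proof.
move=> a0; split=> // s _; rewrite big1 ?sqr_ge0// => k _.
by rewrite /wterm nrm0 expr0n/= mul0r.
Qed.

(** Minkowski's inequality without Cauchy-Schwarz: with X and Y the norms of two
    terms, (X + Y)^2 <= (1 + b/a) X^2 + (1 + a/b) Y^2, and the weights are chosen
    so that the right-hand side sums to (a + b)^2. *)
Lemma l2nD x y a b : l2n x a -> l2n y b -> l2n (fun k => x k + y k) (a + b).
Proof.
wlog suff H : a b / 0 < a -> 0 < b -> l2n x a -> l2n y b ->
    l2n (fun k => x k + y k) (a + b).
  move=> xa yb; have a0 := l2n_ge0 xa; have b0 := l2n_ge0 yb.
  apply: l2n_addgt0; first exact: addr_ge0.
  move=> e e0; have e2 : 0 < e / 2 by rewrite divr_gt0.
  rewrite [e]splitr addrACA; apply: H; rewrite ?ltr_wpDl//.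
    by apply: l2n_le xa; rewrite lerDl ltW.
  by apply: l2n_le yb; rewrite lerDl ltW.
move=> a0 b0 [_ xa] [_ yb]; split=> [|s us]; first by rewrite addr_ge0 ?ltW.
apply: (@le_trans _ _ (\sum_(k <- s) ((1 + b / a) * wterm x k +
    (1 + a / b) * wterm y k))).
  apply: ler_sum => k _; rewrite !wtermE.
  set p := nrm (x k) * _; set q := nrm (y k) * _.
  apply: (@le_trans _ _ ((p + q) ^+ 2)).
    rewrite ler_sqr ?nnegrE ?addr_ge0 ?mulr_ge0 ?nrm_ge0 ?exprz_ge0 ?(ltW rho0)//.
    by rewrite -mulrDl ler_wpM2r ?nrmD// exprz_ge0 ?ltW.
  have -> : (1 + b / a) * p ^+ 2 + (1 + a / b) * q ^+ 2 =
      (p + q) ^+ 2 + (b * p - a * q) ^+ 2 / (a * b).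
    by field; rewrite !gt_eqF.
  by rewrite lerDl divr_ge0 ?sqr_ge0// mulr_ge0 ?ltW.
rewrite big_split/= -!mulr_sumr.
have -> : (a + b) ^+ 2 = (1 + b / a) * a ^+ 2 + (1 + a / b) * b ^+ 2.
  by field; rewrite !gt_eqF.
by rewrite lerD// ler_wpM2l ?xa ?yb// addr_ge0// divr_ge0 ?ltW.
Qed.

Lemma l2nN x a : l2n x a -> l2n (fun k => - x k) a.
Proof.
move=> [a0 xa]; split=> // s /xa; under eq_bigr do rewrite /wterm -nrmN.
by [].
Qed.

Lemma l2nB x y a b : l2n x a -> l2n y b -> l2n (fun k => x k - y k) (a + b).
Proof. by move=> xa /l2nN; exact: l2nD. Qed.

Lemma l2n_sum (I : Type) (s : seq I) (y : I -> int -> V) (p : I -> R) :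
  (forall i, l2n (y i) (p i)) ->
  l2n (fun k => \sum_(i <- s) y i k) (\sum_(i <- s) p i).
Proof.
move=> yp; elim: s => [|i s IH].
  rewrite big_nil (_ : (fun _ => _) = (fun=> 0)); first exact: l2n0.
  by apply/funext => k; rewrite big_nil.
rewrite big_cons (_ : (fun _ => _) =
    (fun k => y i k + \sum_(j <- s) y j k)); first exact: l2nD.
by apply/funext => k; rewrite big_cons.
Qed.

Lemma l2n_shift x a (p : int) :
  l2n x a -> l2n (fun k => x (k + p)) (rho ^ p * a).
Proof.
move=> [a0 xa]; split=> [|s us]; first by rewrite mulr_ge0// exprz_ge0// ltW.
have /xa : uniq [seq k + p | k <- s] by rewrite map_inj_uniq//; exact: addIr.
rewrite big_map exprMn => H.
rewrite (eq_bigr (fun k => (rho ^ p) ^+ 2 * wterm x (k + p))).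
  by rewrite -mulr_sumr ler_wpM2l// sqr_ge0.
move=> k _; rewrite !wtermE -exprMn; congr (_ ^+ 2).
rewrite mulrCA; congr (_ * _); rewrite opprD expfzDr// mulrCA.
by rewrite -expfzDr// subrr expr0z mulr1.
Qed.

(** Fatou's lemma for sequences: each finite sum passes to the limit. *)
Lemma l2n_lim (u : nat -> int -> V) x a :
  (forall n, l2n (u n) a) -> (forall k, u n k @[n --> \oo] --> x k) -> l2n x a.
Proof.
move=> ua ux; split=> [|s us]; first exact: l2n_ge0 (ua 0%N).
have : \sum_(k <- s) wterm (u n) k @[n --> \oo] --> \sum_(k <- s) wterm x k.
  apply: cvg_seq_sum => k; apply: cvgMl.
  have H := cvg_comp _ _ (ux k) (@nrm_continuous _ _ (x k)).
  exact: (cvgM H H).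
by move=> /cvgr_to_le; apply; exists 0%N => // n _; apply: (ua n).2.
Qed.

Lemma l2n_series (y : nat -> int -> V) (p : nat -> R) P x :
  (forall j, l2n (y j) (p j)) -> (forall n, \sum_(j < n) p j <= P) ->
  (forall k, series (fun j => y j k) @ \oo --> x k) -> l2n x P.
Proof.
move=> yp pP; apply: l2n_lim => n.
apply: l2n_le (pP n) _; rewrite -(big_mkord xpredT).
exact: (l2n_sum (index_iota 0 n) yp).
Qed.

Lemma l2n_complete (u : nat -> int -> V) : nrm_complete V ->
  (forall e, 0 < e -> exists N, forall n m, (N <= n)%N -> (N <= m)%N ->
     l2n (fun k => u n k - u m k) e) ->
  exists x, forall e, 0 < e -> exists N, forall n, (N <= n)%N ->
     l2n (fun k => u n k - x k) e.
Proof.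
move=> hV uC.
have H k : exists l : V, u n k @[n --> \oo] --> l.
  apply: (hV (fun n => u n k)) => e e0; have rk : 0 < rho ^ k by rewrite exprz_gt0.
  have e2 : 0 < e / 2 / rho ^ k by rewrite !divr_gt0.
  have [N HN] := uC _ e2; exists N => n m Nn Nm.
  apply: (@le_lt_trans _ _ (e / 2)); last by lra.
  have := l2n_coord k (HN _ _ Nn Nm); by rewrite divfK ?gt_eqF.
have [x Hx] := choice H.
exists x => e /uC[N HN]; exists N => n Nn.
apply: (@l2n_lim (fun m k => u n k - u (N + m)%N k)).
  by move=> m; apply: HN => //; exact: leq_addr.
move=> k; apply: cvgB; first exact: cvg_cst.
rewrite [X in X @ _](_ : _ = (fun m => u (m + N)%N k)); last first.
  by apply/funext => m; rewrite addnC.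
by rewrite (cvg_shiftn N (fun n => u n k)).
Qed.

Definition trunc (n : nat) x (k : int) : V :=
  if (`|k| <= n)%N then x k else 0.

(** A finite set almost attaining the supremum of the finite sums leaves only
    little outside. *)
Lemma l2n_tail x a e : l2n x a -> 0 < e ->
  exists N, forall n, (N <= n)%N -> l2n (fun k => x k - trunc n x k) e.
Proof.
move=> [a0 xa] e0.
pose E := [set X | exists2 s, uniq s & X = \sum_(k <- s) wterm x k].
have hE : has_sup E.
  split; first by exists 0, [::] => //; rewrite big_nil.
  by exists (a ^+ 2) => _ [s us ->]; exact: xa.
have [_ [s us ->] sE] := sup_adherent (exprn_gt0 2 e0) hE.
exists (\max_(k <- s) `|k|%N) => n Nn; split=> [|t ut]; first exact: ltW.
pose t' := [seq k <- t | (n < `|k|)%N].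
have -> : \sum_(k <- t) wterm (fun k => x k - trunc n x k) k =
    \sum_(k <- t') wterm x k.
  rewrite big_filter [RHS]big_mkcond/=; apply: eq_bigr => k _.
  rewrite /wterm /trunc; case: leqP => _; last by rewrite subr0.
  by rewrite subrr nrm0 expr0n/= mul0r.
have ust : uniq (s ++ t').
  rewrite cat_uniq us filter_uniq// andbT; apply/hasPn => k.
  rewrite mem_filter => /andP[nk _]; apply: contraL nk => ks.
  by rewrite -leqNgt (leq_trans _ Nn)// (leq_bigmax_seq _ ks).
have : \sum_(k <- s ++ t') wterm x k <= sup E.
  by apply: sup_upper_bound => //; exists (s ++ t').
rewrite big_cat/=; lra.
Qed.

End one.

Lemma l2n_mul (V W : normedModType R[i]) (x : int -> V) (y : int -> W) a C :
  0 <= C -> (forall k, nrm (x k) <= C * nrm (y k)) -> l2n y a -> l2n x (C * a).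
Proof.
move=> C0 xy [a0 ya]; split=> [|s us]; first exact: mulr_ge0.
apply: (@le_trans _ _ (\sum_(k <- s) C ^+ 2 * wterm y k)).
  apply: ler_sum => k _; rewrite !wtermE -exprMn.
  rewrite ler_sqr ?nnegrE ?mulr_ge0 ?nrm_ge0 ?exprz_ge0 ?(ltW rho0)//.
  by rewrite mulrA ler_wpM2r// exprz_ge0// ltW.
by rewrite -mulr_sumr exprMn ler_wpM2l ?sqr_ge0 ?ya.
Qed.

End weighted_space.

(** * Points of a circle and averages over the angle *)

Section circle_points.
Variable R : realType.

Definition cis (t : R) : R[i] := cos t +i* sin t.

Lemma cis0 : cis 0 = 1.
Proof. by rewrite /cis cos0 sin0. Qed.

Lemma cisD s t : cis (s + t) = cis s * cis t.
Proof.
rewrite /cis cosD sinD; apply/eqP; rewrite eq_complex /= eqxx/=.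
by rewrite addrC.
Qed.

Lemma cis_neq0 t : cis t != 0.
Proof.
apply/eqP => t0; have := cisD t (- t); rewrite subrr cis0 t0 mul0r => /eqP.
by rewrite oner_eq0.
Qed.

Lemma cisN t : cis (- t) = (cis t)^-1.
Proof.
by apply: (mulfI (cis_neq0 t)); rewrite -cisD subrr cis0 divff// cis_neq0.
Qed.

Lemma cisXn t n : cis t ^+ n = cis (n%:R * t).
Proof.
elim: n => [|n IH]; first by rewrite expr0 mul0r cis0.
by rewrite exprS IH -cisD -natr1 mulrDl mul1r addrC.
Qed.

Lemma cisXz t (m : int) : cis t ^ m = cis (m%:~R * t).
Proof.
case: m => n; first by rewrite -exprnP cisXn.
by rewrite NegzE -exprz_inv -exprnP exprVn cisXn -cisN mulrNz mulNr.
Qed.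

Lemma cis2pi : cis (2 * pi) = 1.
Proof. by rewrite /cis mulr_natl cos2pi sin2pi. Qed.

Lemma cis_neq1 (t : R) : 0 < t < 2 * pi -> cis t != 1.
Proof.
move=> /andP[t0 t2]; apply/eqP => -[ct _].
have pos (s : R) : 0 < s <= pi -> cos s != 1.
  move=> /andP[s0 sp]; apply/eqP => cs.
  have : s = 0.
    apply: cos_inj; last by rewrite cos0.
      by rewrite in_itv/= (ltW s0).
    by rewrite in_itv/= lexx pi_ge0.
  by move=> s00; move: s0; rewrite s00 ltxx.
have [tp|tp] := leP t pi; first by move: (pos t); rewrite t0 tp ct eqxx => /(_ isT).
move: (pos (2 * pi - t)); rewrite subr_gt0 t2 addrC mulr_natl cosD2pi cosN ct eqxx.
suff -> : - t + pi *+ 2 <= pi by move=> /(_ isT).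
by rewrite mulr2n; lra.
Qed.

(** The powers of exp (2 i pi / N) detect 0 among the exponents of modulus less
    than N. *)
Lemma roots_of_unity (N : nat) : (0 < N)%N ->
  exists2 w : nat -> R[i], (forall i, cabs (w i) = 1) &
  forall k : int, k != 0 -> (absz k < N)%N -> \sum_(i < N) w i ^ k = 0.
Proof.
move=> N0; have NR : (0 : R) < N%:R by rewrite ltr0n.
have p0 : (0 : R) < 2 * pi by rewrite mulr_gt0// pi_gt0.
pose w := cis (2 * pi / N%:R).
have w1 : cabs w = 1 by rewrite /w /cabs normc_def /= cos2Dsin2 sqrtr1.
exists (fun i => w ^+ i) => [i|k k0 kN]; first by rewrite cabsX w1 expr1n.
have wk : w ^ k != 1.
  suff wn n : (0 < n < N)%N -> w ^+ n != 1.
    case: k k0 kN => n k0 kN; first by apply: wn; rewrite lt0n kN andbT.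
    by rewrite NegzE -exprz_inv -exprnP exprVn invr_eq1; apply: wn; lia.
  move=> /andP[n0 nN]; rewrite cisXn cis_neq1// mulr_gt0 ?ltr0n ?divr_gt0//=.
  by rewrite mulrCA gtr_pMr// ltr_pdivrMr// mul1r ltr_nat.
have -> : \sum_(i < N) (w ^+ i) ^ k = \sum_(i < N) (w ^ k) ^+ i.
  by apply: eq_bigr => i _; rewrite !exprnP !exprz_exp mulrC.
have : (w ^ k) ^+ N = 1.
  rewrite exprnP exprz_exp mulrC -exprz_exp -exprnP cisXn.
  by rewrite mulrC divfK ?gt_eqF// cis2pi exp1rz.
move/eqP; rewrite -subr_eq0 subrX1 mulf_eq0 subr_eq0 (negbTE wk)/=.
by move/eqP.
Qed.

Lemma circle_pointE (rho t : R) : circle_point rho t = rho%:C * cis t.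
Proof.
by apply/eqP; rewrite eq_complex /= !mul0r subr0 addr0 !eqxx.
Qed.

Lemma circle_pointXz (rho t : R) (m : int) :
  circle_point rho t ^ m = (rho ^ m)%:C * cis (m%:~R * t).
Proof.
by rewrite circle_pointE expfzMl cisXz -(fmorphXz (real_complex R)).
Qed.

Lemma cabs_cis t : cabs (cis t) = 1.
Proof. by rewrite /cabs normc_def /= cos2Dsin2 sqrtr1. Qed.

Lemma cabs_circle_point (rho t : R) : 0 <= rho -> cabs (circle_point rho t) = rho.
Proof. by move=> r0; rewrite circle_pointE cabsM cabs_real cabs_cis mulr1 ger0_norm. Qed.

Lemma circle_pointP (rho : R) (z : R[i]) : 0 < rho -> cabs z = rho ->
  exists2 t, `[0, 2 * pi]%classic t & circle_point rho t = z.
Proof.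
move=> r0 zr; have zn : (complex.Re z / rho) ^+ 2 + (complex.Im z / rho) ^+ 2 = 1.
  rewrite !exprMn -mulrDl; have := normc_def z; rewrite cabsE zr => /complexI ->.
  rewrite exprVn sqr_sqrtr ?addr_ge0 ?sqr_ge0// divff// gt_eqF//.
  have : cabs z ^+ 2 = complex.Re z ^+ 2 + complex.Im z ^+ 2.
    have := normc_def z; rewrite cabsE => /complexI ->.
    by rewrite sqr_sqrtr// addr_ge0// sqr_ge0.
  by rewrite zr => <-; rewrite exprn_gt0.
set a := complex.Re z / rho in zn; set b := complex.Im z / rho in zn.
have a1 : -1 <= a <= 1.
  by rewrite -ler_norml -(ler_sqr (_ : `|a| \in Num.nneg) _) ?nnegrE//
    real_normK ?num_real// expr1n -zn lerDl sqr_ge0.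
have [tpi ct] := acos_def a1; set t := acos a in tpi ct.
have st : `|sin t| = `|b|.
  apply/eqP; rewrite -(@eqrXn2 _ 2)// !real_normK ?num_real//.
  by rewrite sin2cos2 ct -zn addrAC subrr add0r.
have st0 : 0 <= sin t by exact: sin_ge0_pi.
have zE : z = (rho * a) +i* (rho * b).
  by rewrite /a /b ![rho * _]mulrC !divfK ?gt_eqF//; case: (z).
have := pi_gt0 R; case/andP: tpi => t0 tp p0.
have [b0|b0] := leP 0 b.
  exists t; first by rewrite /= in_itv/= t0/=; lra.
  by rewrite /circle_point ct zE -[sin t]ger0_norm// st ger0_norm.
exists (2 * pi - t); first by rewrite /= in_itv/=; lra.
rewrite /circle_point addrC mulr_natl cosD2pi sinD2pi cosN sinN ct zE.
by rewrite -[sin t]ger0_norm// st ltr0_norm// opprK.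
Qed.

Lemma continuous_circle_point (rho : R) :
  continuous (circle_point rho : R -> R[i]^o).
Proof.
move=> t; apply/nrm_cvgP => e e0.
have hc : (fun s => `|rho * cos t - rho * cos s| +
                    `|rho * sin t - rho * sin s|) @ t --> (0 : R).
  rewrite -[X in _ --> X](_ : `|rho * cos t - rho * cos t| +
                    `|rho * sin t - rho * sin t| = 0); last first.
    by rewrite !subrr normr0 addr0.
  by apply: cvgD; apply: cvg_norm; apply: cvgB; (try exact: cvg_cst);
    apply: cvgMr; [exact: continuous_cos|exact: continuous_sin].
have /cvgrPdist_lt/(_ _ e0) := hc.
apply: filterS => s /=; rewrite sub0r normrN ger0_norm; last exact: addr_ge0.
by apply: le_lt_trans; exact: (cabs_le_ReIm (circle_point rho t - circle_point rho s)).
Qed.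

Let mu := @lebesgue_measure R.

(** Continuity is part of the notion because it provides the integrability that
    makes averages additive. *)
Definition mean (g : R -> R) (c : R) : Prop :=
  continuous g /\
  (\int[mu]_(t in `[0%R, (2 * pi)%R]) (g t)%:E = (2 * pi * c)%:E)%E.

Lemma mean_cst (c : R) : mean (fun=> c) c.
Proof.
split; first by move=> t; exact: cvg_cst.
rewrite integral_cst//= lebesgue_measure_itv/= lte_fin.
by rewrite mulr_gt0 ?pi_gt0// -EFinB subr0 -EFinM mulrC.
Qed.

Lemma mean_integrable g c : mean g c ->
  mu.-integrable `[0, 2 * pi] (EFin \o g).
Proof.
move=> [gc _]; apply: continuous_compact_integrable; first exact: segment_compact.
exact: continuous_subspaceT.
Qed.

Lemma meanD g1 g2 c1 c2 : mean g1 c1 -> mean g2 c2 ->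
  mean (fun t => g1 t + g2 t) (c1 + c2).
Proof.
move=> m1 m2; split; first by move=> t; apply: cvgD; [exact: m1.1|exact: m2.1].
under eq_integral do rewrite EFinD.
rewrite integralD//=; last 2 first.
- exact: mean_integrable m1.
- exact: mean_integrable m2.
by rewrite m1.2 m2.2 [in RHS]mulrDr EFinD.
Qed.

Lemma mean_sum (I : Type) (s : seq I) (g : I -> R -> R) (c : I -> R) :
  (forall i, mean (g i) (c i)) ->
  mean (fun t => \sum_(i <- s) g i t) (\sum_(i <- s) c i).
Proof.
move=> gc; elim: s => [|i s IH].
  by under eq_fun do rewrite big_nil; rewrite big_nil; exact: mean_cst.
by under eq_fun do rewrite big_cons; rewrite big_cons; exact: meanD.
Qed.

Lemma mean_trig (a b w : R) (m : int) : m != 0 -> w = m%:~R ->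
  mean (fun t => a * cos (w * t) - b * sin (w * t)) 0.
Proof.
move=> m0 wE; have w0 : w != 0 by rewrite wE intr_eq0.
pose F t := (a * sin (w * t) + b * cos (w * t)) / w.
have dF t : is_derive t (1 : R) F (a * cos (w * t) - b * sin (w * t)).
  have d1 : is_derive t (1 : R) ( *%R w) w.
    have := @is_deriveZ _ _ _ _ w _ _ _ (is_derive_id t (1 : R)); rewrite [_ *: 1]mulr1; exact.
  have ds : is_derive t (1 : R) (fun s => sin (w * s)) (cos (w * t) * w).
    exact: is_derive1_comp.
  have dc : is_derive t (1 : R) (fun s => cos (w * s)) (- sin (w * t) * w).
    exact: is_derive1_comp.
  rewrite (_ : F = (w^-1 * a) *: (fun s => sin (w * s)) +
                   (w^-1 * b) *: (fun s => cos (w * s))); last first.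
    apply/funext => s.
    rewrite -[RHS]/(w^-1 * a * sin (w * s) + w^-1 * b * cos (w * s)) /F.
    by field.
  have dF := is_deriveD (is_deriveZ (w^-1 * a) ds) (is_deriveZ (w^-1 * b) dc).
  apply: (is_derive_eq dF).
  rewrite -[LHS]/(w^-1 * a * (cos (w * t) * w) + w^-1 * b * (- sin (w * t) * w)).
  by field.
have p0 : (0 : R) < 2 * pi by rewrite mulr_gt0 ?pi_gt0.
have cF t : {for t, continuous F}.
  by apply: differentiable_continuous; apply/derivable1_diffP; case: (dF t).
have cg : continuous (fun t => a * cos (w * t) - b * sin (w * t)).
  by move=> t; apply: cvgB; apply: cvgMr; (apply: continuous_comp;
    [exact: mulrl_continuous|(exact: continuous_cos || exact: continuous_sin)]).
split=> //; rewrite (@continuous_FTC2 _ _ F)//.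
- have c1 : cis (w * (2 * pi)) = 1.
    by rewrite wE -cisXz cis2pi exp1rz.
  have [/= cc ss] : cis (w * (2 * pi)) = 1 +i* 0 by rewrite c1.
  by rewrite /F cc ss !mulr0 sin0 cos0 mulr0 -EFinB subrr.
- exact: continuous_subspaceT.
- split; first by move=> t _; case: (dF t).
  + by apply: cvg_at_right_filter; exact: cF.
  + by apply: cvg_at_left_filter; exact: cF.
- by move=> t _; rewrite derive1E; case: (dF t).
Qed.

Lemma mean_circle_point (rho : R) (c : R[i]) (m : int) : m != 0 ->
  mean (fun t => complex.Re (c * circle_point rho t ^ m)) 0.
Proof.
move=> m0; have := mean_trig (rho ^ m * complex.Re c) (rho ^ m * complex.Im c)
  m0 erefl; congr mean; apply/funext => t; rewrite circle_pointXz.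
by case: c => a b /=; ring.
Qed.


End circle_points.

(** * Inversion of operators that are bounded below *)

Section inversion.
Variables (R : realType) (V : zmodType) (D : set V) (N : V -> R) (T : V -> V).

(** Approximate solutions of T x = y form a Cauchy sequence because T is bounded
    below, and their limit is a solution because T is bounded. The operator is
    only assumed additive on the subspace D, outside of which it may be
    arbitrary. *)
Lemma invertible_of_approx (B C : R) :
  (forall x y, D x -> D y -> D (x - y)) -> D 0 -> N 0 = 0 ->
  (forall x, 0 <= N x) -> (forall x, D x -> N x <= 0 -> x = 0) ->
  (forall x y, N (x - y) = N (y - x)) ->
  (forall x y z, D x -> D y -> D z -> N (x - z) <= N (x - y) + N (y - z)) ->
  (forall u : nat -> V, (forall n, D (u n)) ->
    (forall e, 0 < e -> exists n0, forall n m, (n0 <= n)%N -> (n0 <= m)%N ->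
       N (u n - u m) <= e) ->
    exists2 x, D x & forall e, 0 < e -> exists n0, forall n, (n0 <= n)%N ->
       N (u n - x) <= e) ->
  (forall x, D x -> D (T x)) ->
  (forall x y, D x -> D y -> T (x - y) = T x - T y) ->
  (forall x, D x -> N (T x) <= B * N x) ->
  0 < C -> (forall x, D x -> N x <= C * N (T x)) ->
  (forall y e, D y -> 0 < e -> exists2 x, D x & N (T x - y) <= e) ->
  invertible_on D N T.
Proof.
move=> DB D0 N0 Nge0 Ndef NC Ntri Ncpl TD TB NT C0 NC' Tapx.
have surj y : exists x, D y -> D x /\ T x = y.
  have [Dy|nDy] := pselect (D y); last by exists 0.
  have He n : exists x, D x /\ N (T x - y) <= n.+1%:R^-1.
    have [x Dx Hx] := Tapx y n.+1%:R^-1 Dy ltac:(by rewrite invr_gt0 ltr0Sn).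
    by exists x.
  have [u Hu] := choice He.
  have small e : 0 < e -> exists n0, forall n, (n0 <= n)%N ->
      N (T (u n) - y) <= e.
    move=> e0.
    have /cvgrPdist_lt/(_ _ e0)[n0 _ H] := @cvg_harmonic R.
    exists n0 => n /H/=; rewrite sub0r normrN ger0_norm ?invr_ge0 ?ler0n//.
    by move=> /ltW; apply: le_trans; exact: (Hu n).2.
  have [x Dx Hx] : exists2 x, D x & forall e, 0 < e -> exists n0, forall n,
      (n0 <= n)%N -> N (u n - x) <= e.
    apply: Ncpl => [n|e e0]; first exact: (Hu n).1.
    have [|n0 Hn0] := small (e / C / 2); first by rewrite !divr_gt0.
    exists n0 => n m nn mm; have [Dn _] := Hu n; have [Dm _] := Hu m.
    rewrite (le_trans (NC' _ (DB _ _ Dn Dm)))// TB// mulrC -ler_pdivlMr//.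
    apply: le_trans (Ntri _ y _ (TD _ Dn) Dy (TD _ Dm)) _.
    by rewrite (splitr (e / C)) lerD ?Hn0// NC Hn0.
  exists x => _; split=> //; apply/eqP; rewrite -subr_eq0; apply/eqP.
  apply: Ndef; first by apply: DB => //; exact: TD.
  apply/ler_addgt0Pr => e e0; rewrite add0r.
  pose b := `|B| + 1; have b0 : 0 < b by rewrite ltr_wpDl.
  have [|n1 H1] := small (e / 2); first by rewrite divr_gt0.
  have [|n2 H2] := Hx (e / 2 / b); first by rewrite !divr_gt0.
  have [Dn _] := Hu (maxn n1 n2).
  apply: le_trans (Ntri _ (T (u (maxn n1 n2))) _ (TD _ Dx) (TD _ Dn) Dy) _.
  rewrite addrC (splitr e) lerD ?H1 ?leq_maxl//.
  rewrite NC -TB// (le_trans (NT _ (DB _ _ Dn Dx)))//.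
  apply: (@le_trans _ _ (b * N (u (maxn n1 n2) - x))).
    by rewrite ler_wpM2r// /b (le_trans (ler_norm B))// lerDl.
  by rewrite mulrC -ler_pdivlMr// H2 ?leq_maxr.
have [S HS] := choice surj; split=> //; exists S; split.
- by move=> y /HS[].
- move=> x Dx; have [DS TS] := HS _ (TD _ Dx).
  apply/eqP; rewrite -subr_eq0; apply/eqP; apply: Ndef; first exact: DB.
  by rewrite (le_trans (NC' _ (DB _ _ DS Dx)))// TB// TS subrr N0 mulr0.
- by move=> y /HS[].
- exists C => y Dy; have [DS TS] := HS _ Dy.
  by rewrite -[in leRHS]TS; exact: NC'.
Qed.

End inversion.

(** * Convolution operators on the weighted space *)

Section convolution.
Variables (R : realType) (H : normedModType R[i]) (hH : nrm_complete H).
Variables (rho : R) (rho1 : 1 < rho).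
Variables (c : nat -> R[i]) (c1 : forall j, cabs (c j) <= 1).
Local Notation l2n := (l2n rho).
Implicit Types (u v x y : int -> H) (a b : R) (z : R[i]).

Let rho0 : 0 < rho. Proof. exact: lt_trans rho1. Qed.
Let rhoN0 : rho != 0. Proof. exact: lt0r_neq0. Qed.
Let r := rho^-1.
Let r0 : 0 <= r. Proof. by rewrite invr_ge0 ltW. Qed.
Let r1 : r < 1. Proof. by rewrite invf_lt1. Qed.
Let r01 : 0 <= r < 1. Proof. by rewrite r0 r1. Qed.

Definition conv (u : int -> H) (k : int) : H :=
  lim (series (fun j : nat => c j *: u (k - j%:Z)) @ \oo).

(** The symbol of [conv]: the generating function of c in the variable 1 / z. *)
Definition gen (z : R[i]) : R[i] :=
  lim (series (fun j : nat => c j * z^-1 ^+ j : R[i]^o) @ \oo).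

Lemma rhoBn (k : int) (j : nat) : rho ^ (k - j%:Z) = rho ^ k * r ^+ j.
Proof. by rewrite expfzDr// -exprz_inv. Qed.

Lemma conv_term u a k j : l2n u a ->
  nrm (c j *: u (k - j%:Z)) <= a * rho ^ k * r ^+ j.
Proof.
move=> ua; rewrite nrmZ -mulrA -rhoBn (le_trans (ler_piMl (nrm_ge0 _) (c1 j)))//.
exact: l2n_coord.
Qed.

Lemma conv_cvg u a k : l2n u a ->
  series (fun j : nat => c j *: u (k - j%:Z)) @ \oo --> conv u k.
Proof.
move=> ua; have [l ul] := geo_series_cvg hH r01 (fun j => conv_term k j ua).
by rewrite /conv (cvg_lim _ ul)//; exact: norm_hausdorff.
Qed.

Lemma gen_term z j : cabs z = rho ->
  @nrm R R[i]^o (c j * z^-1 ^+ j) <= 1 * r ^+ j.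
Proof.
move=> zr; rewrite -[leLHS]/(cabs _) cabsM cabsX cabsV zr ler_wpM2r//.
by rewrite exprn_ge0.
Qed.

Lemma gen_cvg z : cabs z = rho ->
  series (fun j : nat => c j * z^-1 ^+ j : R[i]^o) @ \oo --> (gen z : R[i]^o).
Proof.
move=> zr.
have [l ul] := geo_series_cvg (@complex_complete R) r01 (fun j => gen_term j zr).
by rewrite /gen (cvg_lim _ ul)//; exact: norm_hausdorff.
Qed.

Lemma gen_tail z n : cabs z = rho ->
  cabs (gen z - \sum_(j < n) c j * z^-1 ^+ j) <= r ^+ n / (1 - r).
Proof.
move=> zr; have := geo_series_lim n r01 (fun j => gen_term j zr) (gen_cvg zr).
by rewrite /series/= big_mkord mul1r; exact.
Qed.

Lemma l2n_scale_shift u a (m : int) (d : R[i]) :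
  l2n u a -> l2n (fun k => d *: u (k + m)) (cabs d * (rho ^ m * a)).
Proof.
move=> /(l2n_shift rho1 m); apply: l2n_mul => //; first exact: cabs_ge0.
by move=> k; rewrite nrmZ.
Qed.

(** The remainder is a series of shifts of u, whose norms decay
    geometrically. *)
Lemma conv_tail u a n : l2n u a ->
  l2n (fun k => conv u k - \sum_(j < n) c j *: u (k - j%:Z))
      (a * r ^+ n / (1 - r)).
Proof.
move=> ua; have a0 := l2n_ge0 ua.
apply: (@l2n_series _ _ rho1 _ (fun m k => c (n + m)%N *: u (k - (n + m)%:Z))
  (fun m => a * r ^+ n * r ^+ m)).
- move=> m.
  have := l2n_scale_shift (- (n + m)%:Z) (c (n + m)%N) ua; apply: l2n_le => //.
  rewrite -[- _]add0r rhoBn expr0z mul1r (le_trans (ler_piMl _ (c1 _)))//.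
    by rewrite mulr_ge0// exprn_ge0.
  by rewrite exprD mulrC mulrA.
- move=> m; rewrite -mulr_sumr ler_wpM2l ?geo_sum_le// mulr_ge0// exprn_ge0//.
- move=> k; have := conv_cvg (k := k) ua; rewrite -(cvg_shiftn n) => /= H1.
  have -> : series (fun m => c (n + m)%N *: u (k - (n + m)%:Z)) =
      (fun m => series (fun j : nat => c j *: u (k - j%:Z)) (m + n)%N -
                \sum_(j < n) c j *: u (k - j%:Z)).
    apply/funext => m; rewrite /series/=.
    rewrite [X in _ = X - _](big_cat_nat _ (n := n)) ?leq_addl//=.
    rewrite -(big_mkord xpredT (fun j => c j *: u (k - j%:Z))).
    rewrite [RHS]addrAC subrr add0r -[X in index_iota X (m + n)]add0n.
    by rewrite big_addn addnK; apply: eq_bigr => i _; rewrite addnC.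
  by apply: cvgB => //; exact: cvg_cst.
Qed.

Lemma conv_l2n u a : l2n u a -> l2n (conv u) (a / (1 - r)).
Proof.
move=> /(conv_tail 0); rewrite expr0 mulr1.
by under [X in l2n X _ -> _]funext do rewrite big_ord0 subr0.
Qed.

Lemma convB u v a b : l2n u a -> l2n v b ->
  conv (fun k => u k - v k) = (fun k => conv u k - conv v k).
Proof.
move=> ua vb; apply/funext => k.
apply: (cvg_lim (@norm_hausdorff _ _)).
rewrite (_ : series _ = series (fun j : nat => c j *: u (k - j%:Z)) \-
    series (fun j : nat => c j *: v (k - j%:Z))).
  by apply: cvgB; [exact: conv_cvg ua|exact: conv_cvg vb].
apply/funext => n; rewrite /series/= -sumrB; apply: eq_bigr => j _.
by rewrite scalerBr.
Qed.

Lemma convZ u a (d : R[i]) : l2n u a ->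
  conv (fun k => d *: u k) = (fun k => d *: conv u k).
Proof.
move=> ua; apply/funext => k.
apply: (cvg_lim (@norm_hausdorff _ _)).
rewrite (_ : series _ = (fun n => d *: series (fun j : nat => c j *: u (k - j%:Z)) n)).
  by apply: cvgZr; exact: conv_cvg ua.
apply/funext => n; rewrite /series/= scaler_sumr; apply: eq_bigr => j _.
by rewrite !scalerA mulrC.
Qed.

Lemma convD u v a b : l2n u a -> l2n v b ->
  conv (fun k => u k + v k) = (fun k => conv u k + conv v k).
Proof.
move=> ua vb; rewrite (_ : (fun k => u k + v k) = (fun k => u k - -1 *: v k)).
  rewrite (@convB u _ a b)//.
    by apply/funext => k; rewrite (convZ _ vb) scaleN1r opprK.
  by under [X in l2n X]funext do rewrite scaleN1r; exact: l2nN.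
by apply/funext => k; rewrite scaleN1r opprK.
Qed.

Lemma conv_shift u (m k : int) :
  conv (fun k => u (k + m)) k = conv u (k + m).
Proof. by rewrite /conv; under eq_fun do rewrite addrAC. Qed.

(** The normalization makes the geometric sequences z ^ k h fixed points, and
    makes the shift an isometry when z lies on the circle. *)
Definition dil (z : R[i]) (m : int) (x : int -> H) (k : int) : H :=
  z ^ (- m) *: x (k + m).

Lemma l2n_dil z m x a : cabs z = rho -> l2n x a -> l2n (dil z m x) a.
Proof.
move=> zr xa; have := l2n_scale_shift m (z ^ (- m)) xa.
by rewrite cabsXz zr mulrA -expfzDr// addNr expr0z mul1r.
Qed.

Lemma dilD z m n x : z != 0 -> dil z (m + n) x = dil z m (dil z n x).
Proof.
move=> z0; apply/funext => k; rewrite /dil scalerA -expfzDr// opprD addrA.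
by [].
Qed.

Lemma dilB z m x y :
  dil z m (fun k => x k - y k) = (fun k => dil z m x k - dil z m y k).
Proof. by apply/funext => k; rewrite /dil scalerBr. Qed.

Lemma dil0 z x : dil z 0 x = x.
Proof. by apply/funext => k; rewrite /dil oppr0 expr0z scale1r addr0. Qed.

Lemma l2n_dil_diff z m x b : cabs z = rho ->
  l2n (fun k => dil z 1 x k - x k) b ->
  l2n (fun k => dil z m x k - x k) (`|m|%N%:R * b).
Proof.
move=> zr xb; have z0 : z != 0.
  by apply/eqP => z0; move: zr rho0; rewrite z0 /cabs normr0 => <-; rewrite ltxx.
have pos (n : nat) : l2n (fun k => dil z n x k - x k) (n%:R * b).
  elim: n => [|n IH].
    rewrite dil0 mul0r (_ : (fun _ => _) = (fun=> 0)); first exact: l2n0.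
    by apply/funext => k; rewrite subrr.
  rewrite -natr1 mulrDl mul1r addrC.
  rewrite (_ : (fun _ => _) = (fun k => dil z n (fun k => dil z 1 x k - x k) k
      + (dil z n x k - x k))).
    by apply: l2nD => //; exact: l2n_dil.
  apply/funext => k; rewrite dilB -dilD//= addrA subrK.
  by rewrite -PoszD addn1.
case: m => n; first exact: pos.
rewrite NegzE abszN /=.
rewrite (_ : (fun _ => _) = (fun k => - dil z (- n.+1%:Z)
    (fun k => dil z n.+1 x k - x k) k)).
  by apply: l2nN; apply: l2n_dil => //; exact: pos.
by apply/funext => k; rewrite dilB -dilD// addNr dil0 opprB.
Qed.

(* The sum of rho ^ (1 - j) * (j + 1) over j, which bounds the sum of
   rho ^ (1 - j) * |1 - j|. *)
Let kappa := rho * (1 - r) ^- 2.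

(** Each power of the normalized shift almost fixes x, with an error growing
    linearly in the exponent, and the difference below is the sum of these
    errors against c_j z^(1 - j). *)
Lemma approx_eigen z x a b : cabs z = rho -> l2n x a ->
  l2n (fun k => dil z 1 x k - x k) b ->
  l2n (fun k => conv x (k + 1) - (z * gen z) *: x k) (kappa * b).
Proof.
move=> zr xa xb; have b0 := l2n_ge0 xb.
have z0 : z != 0.
  by apply/eqP => z0; move: zr rho0; rewrite z0 /cabs normr0 => <-; rewrite ltxx.
have zE (j : nat) : z ^ (1 - j%:Z) = z * z^-1 ^+ j.
  by rewrite expfzDr// expr1z -exprz_inv.
apply: (@l2n_series _ _ rho1 _
  (fun j k => (c j * z ^ (1 - j%:Z)) *: (dil z (1 - j%:Z) x k - x k))
  (fun j => rho * r ^+ j * (j.+1%:R * b))).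
- move=> j; apply: (@l2n_mul _ _ rho1 _ _ _ (fun k => dil z (1 - j%:Z) x k - x k)).
  + by rewrite mulr_ge0 ?exprn_ge0// ltW.
  + move=> k; rewrite nrmZ ler_wpM2r ?nrm_ge0// cabsM cabsXz zr rhoBn expr1z.
    by rewrite ler_piMl// mulr_ge0 ?exprn_ge0// ltW.
  + have := l2n_dil_diff (1 - j%:Z) zr xb; apply: l2n_le => //.
    by rewrite ler_wpM2r// ler_nat; lia.
- move=> n; rewrite (eq_bigr (fun j : 'I_n => rho * b * (j.+1%:R * r ^+ j))).
    rewrite -mulr_sumr /kappa [leRHS]mulrAC ler_wpM2l ?mulr_ge0 ?(ltW rho0)//.
    exact: arith_geo_sum_le.
  by move=> j _; ring.
- move=> k.
  rewrite (_ : series _ = (fun n =>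
     series (fun j : nat => c j *: x (k + 1 - j%:Z)) n -
     (z * (series (fun j => c j * z^-1 ^+ j : R[i]^o) n : R[i])) *: x k)).
    apply: cvgB; first exact: conv_cvg xa.
    by apply: cvgZl; apply: cvgMr; exact: gen_cvg zr.
  apply/funext => n; rewrite /series/= mulr_sumr scaler_suml -sumrB.
  apply: eq_bigr => j _; rewrite scalerBr /dil scalerA -mulrA -expfzDr// subrr.
  by rewrite expr0z mulr1 addrA zE mulrCA.
Qed.

End convolution.

(** * Windows and waves *)

Section windows.
Variable R : realType.

Lemma sum_supp_le (f : int -> R) (B : R) (N : nat) (s : seq int) : uniq s ->
  (forall k, f k <= B) -> (forall k, (N < `|k|)%N -> f k = 0) ->
  0 <= B -> \sum_(k <- s) f k <= (2 * N).+1%:R * B.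
Proof.
move=> us fB f0 B0; pose t := [seq k <- s | (`|k| <= N)%N].
have -> : \sum_(k <- s) f k = \sum_(k <- t) f k.
  rewrite [RHS]big_filter [RHS]big_mkcond; apply: eq_bigr => k _.
  by case: leqP => // /f0.
apply: (@le_trans _ _ (\sum_(k <- t) B)); first exact: ler_sum.
rewrite big_const_seq count_predT iter_addr_0 -[leLHS]mulr_natl ler_wpM2r// ler_nat.
have inj : {in t &, injective (fun k : int => absz (k + N%:Z))}.
  by move=> k l; rewrite !mem_filter => /andP[kN _] /andP[lN _]; lia.
rewrite -(size_map (fun k : int => absz (k + N%:Z))).
rewrite -[X in (_ <= X)%N](size_iota 0); apply: uniq_leq_size.
  by rewrite map_inj_in_uniq// filter_uniq.
move=> _ /mapP[k + ->]; rewrite mem_filter mem_iota => /andP[kN _].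
by apply/andP; split; lia.
Qed.

Lemma uniq_sum_shift (f : int -> R) (B : R) (p : int) :
  (forall s, uniq s -> \sum_(k <- s) f k <= B) ->
  forall s, uniq s -> \sum_(k <- s) f (k - p) <= B.
Proof.
move=> fB s us; rewrite -(big_map (fun k => k - p) xpredT f) fB//.
by rewrite map_inj_uniq//; exact: addIr.
Qed.

Definition tent (N : nat) (k : int) : R := (N - `|k|)%N%:R / N%:R.

(** A tent of half-width N has 2 N increments of size 1 / N, so the sum of their
    squares is of order 1 / N. *)
Lemma window (e : R) (p : int) : 0 < e ->
  exists chi : int -> R, exists N : nat, exists2 a : R, 0 <= a &
  [/\ chi p = 1, forall k, (N <= `|(k - p)%R|)%N -> chi k = 0,
      forall s, uniq s -> \sum_(k <- s) chi k ^+ 2 <= a ^+ 2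
    & forall s, uniq s -> \sum_(k <- s) (chi (k + 1) - chi k) ^+ 2 <= e ^+ 2].
Proof.
move=> e0; have e20 : 0 < e ^+ 2 by rewrite exprn_gt0.
have [N HN] : exists N : nat, (3 : R) < N%:R * e ^+ 2.
  exists (Num.bound (3 / e ^+ 2)); rewrite -ltr_pdivrMr//.
  by rewrite archi_boundP// divr_ge0// ltW.
have N0 : (0 < N)%N by case: N HN => //; rewrite mul0r; lra.
have NR0 : (0 : R) < N%:R by rewrite ltr0n.
exists (fun k => tent N (k - p)), N, (Num.sqrt (2 * N).+1%:R).
  exact: sqrtr_ge0.
split.
- by rewrite subrr /tent subn0 divff// gt_eqF.
- by move=> k; rewrite /tent -subn_eq0 => /eqP->; rewrite mul0r.
- apply: (@uniq_sum_shift (fun k => tent N k ^+ 2)) => s us.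
  rewrite sqr_sqrtr ?ler0n// -[leRHS]mulr1; apply: sum_supp_le => //.
    move=> k; rewrite -[leRHS](expr1n _ 2) ler_sqr ?nnegrE ?divr_ge0 ?ler0n//.
    by rewrite ler_pdivrMr// mul1r ler_nat leq_subr.
  by move=> k /ltnW; rewrite /tent -subn_eq0 => /eqP->; rewrite mul0r expr0n.
- move=> s us; under eq_bigr do rewrite addrAC.
  move: s us; apply: (@uniq_sum_shift (fun k => (tent N (k + 1) - tent N k) ^+ 2)).
  move=> s us; apply: (@le_trans _ _ ((2 * N).+1%:R * N%:R^-1 ^+ 2)).
    apply: sum_supp_le => //.
    + move=> k; rewrite /tent -mulrBl exprMn ler_piMl ?sqr_ge0//.
      rewrite -real_normK ?num_real// expr_le1//.
      have [H|H] : (N - `|(k + 1)%R|)%N = (N - `|k|)%N \/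
          (N - `|(k + 1)%R|)%N = (N - `|k|).+1 \/
          (N - `|k|)%N = (N - `|(k + 1)%R|).+1 by lia.
        by rewrite H subrr normr0.
      case: H => ->; rewrite -natr1; first by rewrite addrAC subrr add0r normr1.
      by rewrite opprD addrA subrr add0r normrN normr1.
    + move=> k Nk; have [H1 H2] : (N - `|(k + 1)%R|)%N = 0%N /\
          (N - `|k|)%N = 0%N by lia.
      by rewrite /tent H1 H2 mul0r subrr expr0n.
  rewrite exprVn ler_pdivrMr ?exprn_gt0// expr2 mulrA.
  have : (2 * N).+1%:R <= 3 * N%:R :> R by rewrite -natrM ler_nat; lia.
  nra.
Qed.

End windows.

Section spectrum_transfer.
Variables (R : realType) (H : completeNormedModType R[i]).
Variables (A : {linear H -> H}) (MA : R) (MA0 : 0 <= MA).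
Hypothesis hA : forall x, nrm (A x) <= MA * nrm x.
Variables (rho : R) (rho1 : 1 < rho).
Variables (c : nat -> R[i]) (c1 : forall j, cabs (c j) <= 1).
Local Notation l2n := (l2n rho).
Local Notation conv := (conv c).
Local Notation gen := (gen c).
Implicit Types (u v x y : int -> H) (a b e : R) (z : R[i]) (g h : H).

Let rho0 : 0 < rho. Proof. exact: lt_trans rho1. Qed.
Let rhoN0 : rho != 0. Proof. exact: lt0r_neq0. Qed.
Let hH : nrm_complete H := @complete_nrm R H.

Lemma resolvent_of_approx (l : R[i]) C : 0 < C ->
  (forall h, nrm h <= C * nrm (l *: h - A h)) ->
  (forall h e, 0 < e -> exists g, nrm (l *: g - A g - h) <= e) ->
  resolvent_set A l.
Proof.
move=> C0 HC Happ; pose L h := l *: h - A h.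
apply: (@invertible_of_approx R H [set: H] (@nrm R H) L
  (cabs l + MA) C) => //.
- exact: nrm0.
- exact: nrm_ge0.
- by move=> h _ h0; apply: nrm_eq0; apply/eqP; rewrite eq_le h0 nrm_ge0.
- exact: nrm_distC.
- by move=> h1 h2 h3 _ _ _; exact: nrm_distD.
- move=> u _ uC; have [e e0|v uv] := hH (u := u).
    have [|n0 Hn] := uC (e / 2); first by rewrite divr_gt0.
    exists n0 => n m nn mm; rewrite (le_lt_trans (Hn _ _ nn mm))//; lra.
  exists v => // e e0; have /nrm_cvgP/(_ _ e0)[n0 _ Hn] := uv.
  by exists n0 => n /Hn/ltW; rewrite nrm_distC.
- by move=> h1 h2 _ _; rewrite /L scalerBr raddfB/= !opprD opprK addrACA.
- move=> h _; rewrite /L (le_trans (nrmB _ _))// nrmZ mulrDl lerD2l.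
  exact: hA.
- by move=> h e _ e0; have [g Hg] := Happ h e e0; exists g.
Qed.

(** The operator of the theorem, with a convolution in place of the fractional
    difference. *)
Definition opT u (k : int) : H := conv u (k + 1) - A (u k).

Let kappa : R := rho * (1 - rho^-1) ^- 2.

Let kappa0 : 0 < kappa.
Proof. by rewrite mulr_gt0// invr_gt0 exprn_gt0// subr_gt0 invf_lt1. Qed.

Lemma l2n_opT u a : l2n u a ->
  l2n (opT u) ((rho / (1 - rho^-1) + MA) * a).
Proof.
move=> ua; rewrite mulrDl; apply: l2nB => //; last exact: l2n_mul ua.
have := l2n_shift rho1 1 (conv_l2n hH rho1 c1 ua).
by rewrite expr1z => cu; rewrite mulrAC -mulrA.
Qed.

Lemma opTB u v a b : l2n u a -> l2n v b ->
  opT (fun k => u k - v k) = (fun k => opT u k - opT v k).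
Proof.
move=> ua vb; apply/funext => k; rewrite /opT (convB hH rho1 c1 ua vb) raddfB/=.
by rewrite !opprD opprK addrACA.
Qed.

Lemma opTD u v a b : l2n u a -> l2n v b ->
  opT (fun k => u k + v k) = (fun k => opT u k + opT v k).
Proof.
move=> ua vb; apply/funext => k; rewrite /opT (convD hH rho1 c1 ua vb) raddfD/=.
by rewrite opprD addrACA.
Qed.

Lemma opTZ d u a : l2n u a ->
  opT (fun k => d *: u k) = (fun k => d *: opT u k).
Proof.
move=> ua; apply/funext => k; rewrite /opT (convZ hH rho1 c1 d ua) linearZ/=.
by rewrite scalerBr.
Qed.

Lemma opT_dil z m u a : l2n u a -> opT (dil z m u) = dil z m (opT u).
Proof.
move=> ua; apply/funext => k; rewrite /opT /dil.
rewrite (convZ hH rho1 c1 _ (l2n_shift rho1 m ua)) conv_shift linearZ/= scalerBr.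
by rewrite addrAC.
Qed.

Lemma opT0 : opT (fun=> 0) = (fun=> 0).
Proof.
have x0 : l2n (fun=> 0 : H) 0 by exact: l2n0.
have := opTB x0 x0; under [X in opT X]funext do rewrite subrr.
by move=> ->; apply/funext => k; rewrite subrr.
Qed.

Lemma opT_sum (I : Type) (s : seq I) (y : I -> int -> H) (a : I -> R) :
  (forall i, l2n (y i) (a i)) ->
  opT (fun k => \sum_(i <- s) y i k) = (fun k => \sum_(i <- s) opT (y i) k).
Proof.
move=> ya; elim: s => [|i s IH].
  under [X in opT X]funext do rewrite big_nil.
  by rewrite opT0; apply/funext => k; rewrite big_nil.
under [X in opT X]funext do rewrite big_cons.
rewrite (opTD (ya i) (l2n_sum rho1 s ya)) IH.
by apply/funext => k; rewrite big_cons.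
Qed.

(** The geometric sequence z ^ k h is formally an eigenvector of the convolution
    operators, but it is not square summable; the window chi cuts it off. *)
Definition wave z (chi : int -> R) h (k : int) : H := ((chi k)%:C * z ^ k) *: h.

Lemma l2n_wave z chi a h : cabs z = rho -> 0 <= a ->
  (forall s, uniq s -> \sum_(k <- s) chi k ^+ 2 <= a ^+ 2) ->
  l2n (wave z chi h) (a * nrm h).
Proof.
move=> zr a0 Ha; split=> [|s us]; first by rewrite mulr_ge0// nrm_ge0.
rewrite (eq_bigr (fun k => chi k ^+ 2 * nrm h ^+ 2)).
  by rewrite -mulr_suml exprMn ler_wpM2r ?sqr_ge0 ?Ha.
move=> k _; rewrite wtermE// /wave nrmZ cabsM cabs_real cabsXz zr.
rewrite -exprMn; rewrite [X in X ^+ 2](_ : _ = `|chi k| * nrm h).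
  by rewrite !exprMn real_normK// num_real.
rewrite -!mulrA; congr (_ * _); rewrite mulrCA -expfzDr// subrr expr0z.
by rewrite mulr1.
Qed.

Lemma circle_neq0 z : cabs z = rho -> z != 0.
Proof.
move=> zr; apply/eqP => z0; move: zr rho0.
by rewrite z0 /cabs normr0 => <-; rewrite ltxx.
Qed.

Lemma dil_wave z chi h : cabs z = rho ->
  (fun k => dil z 1 (wave z chi h) k - wave z chi h k) =
  wave z (fun k => chi (k + 1) - chi k) h.
Proof.
move=> /circle_neq0 z0; apply/funext => k; rewrite /dil /wave scalerA.
rewrite -scalerBl; congr (_ *: _); rewrite rmorphB/= mulrBl; congr (_ - _).
by rewrite mulrCA -expfzDr// addrA addrAC addNr add0r.
Qed.

Lemma opT_wave z chi a e h : cabs z = rho -> 0 <= a -> 0 <= e ->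
  (forall s, uniq s -> \sum_(k <- s) chi k ^+ 2 <= a ^+ 2) ->
  (forall s, uniq s -> \sum_(k <- s) (chi (k + 1) - chi k) ^+ 2 <= e ^+ 2) ->
  l2n (fun k => opT (wave z chi h) k -
                wave z chi ((z * gen z) *: h - A h) k) (kappa * (e * nrm h)).
Proof.
move=> zr a0 e0 Ha He.
have W := l2n_wave h zr a0 Ha.
rewrite (_ : (fun k => opT _ k - _) = (fun k =>
    conv (wave z chi h) (k + 1) - (z * gen z) *: wave z chi h k)).
  apply: (approx_eigen hH rho1 c1 zr W); rewrite dil_wave//.
  exact: l2n_wave.
apply/funext => k; rewrite /opT {2 3}/wave linearZ/= scalerBr opprB addrA.
by rewrite subrK /wave !scalerA [_ * (z * _)]mulrC.
Qed.

(** * From invertibility to the resolvent set *)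

Section necessity.
Hypothesis invT : invertible_on (@ell2 R H rho) (@ell2_norm R H rho) opT.

Let inverse : exists S : (int -> H) -> int -> H, exists2 M, 0 < M &
  [/\ forall y b, l2n y b -> l2n (S y) (M * b),
      forall x a, l2n x a -> S (opT x) = x &
      forall y b, l2n y b -> opT (S y) = y].
Proof.
have [_ [S [SD ST TS [M SM]]]] := invT.
exists S, (`|M| + 1); first by rewrite ltr_wpDl.
split.
- move=> y b yb; have yD := l2n_ell2 yb.
  apply: l2n_le (l2n_norm (SD _ yD)) => //.
  rewrite (le_trans (SM _ yD))// (@le_trans _ _ ((`|M| + 1) * ell2_norm rho y))//.
    rewrite ler_wpM2r ?ell2_norm_ge0//.
    by rewrite (le_trans (ler_norm M))// lerDl.
  by rewrite ler_wpM2l ?ell2_norm_le// addr_ge0.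
- by move=> x a /(l2n_ell2)/ST.
- by move=> y b /(l2n_ell2)/TS.
Qed.

(** The lower bound of T is tested on a wave with an amplitude h, and the
    equation with right-hand side h is solved by the entry at 0 of the inverse
    image of such a wave. *)
Lemma resolvent_of_invertible z : cabs z = rho -> resolvent_set A (z * gen z).
Proof.
move=> zr; have [S [M M0 [Sb ST TS]]] := inverse.
have MK0 : 0 < M * kappa by rewrite mulr_gt0.
set L := fun h => (z * gen z) *: h - A h.
have [C C0 HC] : exists2 C, 0 < C & forall h, nrm h <= C * nrm (L h).
  (* The window is chosen once, such that the error costs at most |h| / 2. *)
  have e0 : 0 < (2 * (M * kappa))^-1 by rewrite invr_gt0 mulr_gt0.
  have [chi [N [a a0 [chi0 _ Ha He]]]] := window 0 e0.
  exists (2 * (M * a) + 1); first by rewrite ltr_wpDl// !mulr_ge0// ltW.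
  move=> h; set u := wave z chi h.
  have ua : l2n u (a * nrm h) by exact: l2n_wave.
  have := opT_wave h zr a0 (ltW e0) Ha He; rewrite -/u -/(L h) => Tu.
  have := l2nD rho1 Tu (l2n_wave (L h) zr a0 Ha).
  under [X in l2n X _]funext do rewrite subrK.
  move=> /Sb; rewrite (ST _ _ ua) => /(l2n_coord rho1 0).
  rewrite expr0z mulr1 /u /wave chi0 expr0z mulr1 scale1r.
  have -> : M * (kappa * ((2 * (M * kappa))^-1 * nrm h) + a * nrm (L h)) =
     nrm h / 2 + M * a * nrm (L h).
    by field; rewrite gt_eqF//= gt_eqF.
  have := nrm_ge0 (L h); lra.
apply: (resolvent_of_approx C0 HC) => h e e0.
have h0 := nrm_ge0 h; have h1 : 0 < nrm h + 1 by rewrite ltr_wpDl.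
have e'0 : 0 < e / (nrm h + 1) / (M * kappa) by rewrite !divr_gt0.
have [chi [N [a a0 [chi0 _ Ha He]]]] := window 0 e'0.
set y := wave z chi h; have ya : l2n y (a * nrm h) by exact: l2n_wave.
have := l2n_wave h zr (ltW e'0) He; rewrite -dil_wave// -/y => dy.
(* The inverse commutes with the normalized shift, so x is almost fixed. *)
have xa := Sb _ _ ya; set x := S y in xa; have Tx : opT x = y by exact: TS ya.
have dx : l2n (fun k => dil z 1 x k - x k)
    (M * (e / (nrm h + 1) / (M * kappa) * nrm h)).
  have xd := l2n_dil rho1 1 zr xa.
  rewrite -[X in l2n X](ST _ _ (l2nB rho1 xd xa)); apply: Sb.
  by rewrite (opTB xd xa) (opT_dil _ _ xa) Tx.
have := approx_eigen hH rho1 c1 zr xa dx.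
move=> /(l2n_coord rho1 0); rewrite expr0z mulr1 add0r => Hx.
exists (x 0).
rewrite -/(L (x 0)); have -> : L (x 0) - h = - (conv x 1 - (z * gen z) *: x 0).
  have : opT x 0 = h by rewrite Tx /y /wave chi0 expr0z mulr1 scale1r.
  by rewrite /opT add0r => <-; rewrite /L !opprB addrA subrK addrC.
rewrite nrmN (le_trans Hx)//.
have -> : rho * (1 - rho^-1) ^- 2 *
   (M * (e / (nrm h + 1) / (M * kappa) * nrm h)) = e * (nrm h / (nrm h + 1)).
  rewrite -/kappa; field; rewrite ?gt_eqF//=.
by rewrite ler_piMr ?(ltW e0)// ler_pdivrMr// mul1r lerDl.
Qed.

End necessity.

(** * Dense range from the resolvent *)

Section sufficiency.
Variables (M : R) (M0 : 0 < M).
Hypothesis solve : forall z, cabs z = rho ->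
  forall h, exists2 g, (z * gen z) *: g - A g = h & nrm g <= M * nrm h.

Definition in_closure y : Prop := forall e, 0 < e ->
  exists2 x, exists a, l2n x a & l2n (fun k => opT x k - y k) e.

Lemma in_closureD y1 y2 : in_closure y1 -> in_closure y2 ->
  in_closure (fun k => y1 k + y2 k).
Proof.
move=> Y1 Y2 e e0; have e2 : 0 < e / 2 by rewrite divr_gt0.
have [x1 [a1 xa1] H1] := Y1 _ e2; have [x2 [a2 xa2] H2] := Y2 _ e2.
exists (fun k => x1 k + x2 k).
  by exists (a1 + a2); exact: l2nD.
rewrite (opTD xa1 xa2) (splitr e).
under [X in l2n X]funext do rewrite opprD addrACA.
exact: l2nD.
Qed.

Lemma in_closure_sum (I : Type) (s : seq I) (y : I -> int -> H) :
  (forall i, in_closure (y i)) -> in_closure (fun k => \sum_(i <- s) y i k).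
Proof.
move=> Hy; elim: s => [|i s IH].
  move=> e e0; have x0 : l2n (fun=> 0 : H) 0 by exact: l2n0.
  exists (fun=> 0); first by exists 0.
  rewrite (_ : (fun _ => _) = opT (fun=> 0)); last first.
    by apply/funext => k; rewrite big_nil subr0.
  have := l2n_opT x0; rewrite mulr0; exact: l2n_le (ltW e0).
under [X in in_closure X]funext do rewrite big_cons.
exact: in_closureD.
Qed.

(** Averaging z ^ (k - p) over the points z = rho w, with w running over the roots
    of unity of an order above the half-width of the window, leaves only k = p.
    Each of the averaged waves has an approximate preimage, a wave whose
    amplitude solves the equation at the corresponding z. *)
Lemma in_closure_spike (p : int) h :
  in_closure (fun k => if k == p then h else 0).
Proof.
move=> e e0; set q := M * (rho ^ (- p) * nrm h).
have q0 : 0 <= q.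
  by rewrite mulr_ge0 ?(ltW M0)// mulr_ge0 ?nrm_ge0// exprz_ge0 ?ltW.
have q1 : 0 < q + 1 by rewrite ltr_wpDl.
have e'0 : 0 < e / (q + 1) / kappa by rewrite divr_gt0// divr_gt0.
have [chi [N [a a0 [chip chiN Ha He]]]] := window p e'0.
have [w w1 w0] := roots_of_unity R (ltn0Sn N).
pose z i := rho%:C * w i.
have zr i : cabs (z i) = rho by rewrite cabsM w1 mulr1 cabs_real gtr0_norm.
have sol i : exists g, (z i * gen (z i)) *: g - A g = z i ^ (- p) *: h /\
    nrm g <= q.
  have [g g1 g2] := solve (zr i) (z i ^ (- p) *: h); exists g; split=> //.
  by move: g2; rewrite nrmZ cabsXz zr.
have [g Hg] := choice sol.
pose d : R[i] := (N.+1%:R^-1)%:C.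
have dE : cabs d = N.+1%:R^-1 by rewrite cabs_real ger0_norm// invr_ge0.
pose W i k := d *: wave (z i) chi (g i) k.
have Wa i : l2n (W i) (cabs d * (a * nrm (g i))).
  apply: l2n_mul (l2n_wave (g i) (zr i) a0 Ha) => //; first exact: cabs_ge0.
  by move=> k; rewrite nrmZ.
have WT i : l2n (fun k => opT (W i) k -
    d *: wave (z i) chi (z i ^ (- p) *: h) k) (N.+1%:R^-1 * (kappa *
      (e / (q + 1) / kappa * q))).
  rewrite (opTZ d (l2n_wave (g i) (zr i) a0 Ha)) -dE.
  have := opT_wave (g i) (zr i) a0 (ltW e'0) Ha He; rewrite (Hg i).1 => err.
  under [X in l2n X]funext do rewrite -scalerBr.
  apply: l2n_le (l2n_mul rho1 (cabs_ge0 d) _ err) => [|k].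
    by rewrite ler_wpM2l ?cabs_ge0// ler_wpM2l ?(ltW kappa0)// ler_wpM2l ?(ltW e'0)// (Hg i).2.
  by rewrite nrmZ.
exists (fun k => \sum_(i < N.+1) W i k).
  by exists (\sum_(i < N.+1) cabs d * (a * nrm (g i))); exact: l2n_sum.
rewrite (@opT_sum _ _ (fun i : 'I_N.+1 => W i)
  (fun i => cabs d * (a * nrm (g i))))//.
have spikeE k : (if k == p then h else 0) =
    \sum_(i < N.+1) d *: wave (z i) chi (z i ^ (- p) *: h) k.
  have -> : \sum_(i < N.+1) d *: wave (z i) chi (z i ^ (- p) *: h) k =
      (d * ((chi k * rho ^ (k - p))%:C * \sum_(i < N.+1) w i ^ (k - p))) *: h.
    rewrite !mulr_sumr scaler_suml; apply: eq_bigr => i _.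
    rewrite /wave !scalerA; congr (_ *: _); rewrite -!mulrA; congr (_ * _).
    rewrite rmorphM/= -!mulrA; congr (_ * _).
    rewrite -expfzDr ?circle_neq0// expfzMl.
    by rewrite -(fmorphXz (real_complex R)).
  case: (eqVneq k p) => [->|kp].
    rewrite chip subrr expr0z mulr1 mul1r.
    under eq_bigr do rewrite expr0z.
    rewrite sumr_const card_ord.
    by rewrite -(rmorph_nat (real_complex R)) -rmorphM/= mulVf// rmorph1 scale1r.
  have [kN|kN] := leqP N `|(k - p)%R|%N.
    by rewrite chiN// mul0r mul0r mulr0 scale0r.
  by rewrite w0 ?subr_eq0// ?mulr0 ?scale0r//; apply: ltnW.
under [X in l2n X]funext do rewrite spikeE -sumrB.
have := l2n_sum rho1 (index_enum 'I_N.+1) (fun i => WT i).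
apply: l2n_le => //; rewrite sumr_const card_ord -[leLHS]mulr_natl mulVKf//.
have -> : kappa * (e / (q + 1) / kappa * q) = e * (q / (q + 1)).
  by field; rewrite ?gt_eqF.
by rewrite ler_piMr ?(ltW e0)// ler_pdivrMr// mul1r lerDl.
Qed.

Lemma dense_range y a : l2n y a -> in_closure y.
Proof.
move=> ya e e0; have e2 : 0 < e / 2 by rewrite divr_gt0.
have [N /(_ _ (leqnn N)) tail] := l2n_tail ya e2.
pose s := window_seq N.
have truncE k : trunc N y k = \sum_(p <- s) (if k == p then y p else 0).
  rewrite /trunc -mem_window_seq; case: ifPn => ks.
    rewrite (bigD1_seq k) ?window_seq_uniq//= eqxx big1 ?addr0// => p.
    by rewrite eq_sym => /negbTE ->.
  by rewrite big_seq big1// => p ps; case: eqP => // kp; rewrite kp ps in ks.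
have [x xa Hx] := in_closure_sum s (fun p => in_closure_spike p (y p)) e2.
exists x => //; rewrite (splitr e).
rewrite (_ : (fun k => opT x k - y k) = (fun k =>
    opT x k - \sum_(p <- s) (if k == p then y p else 0) -
    (y k - trunc N y k))); first exact: l2nB.
by apply/funext => k; rewrite truncE opprB addrA subrK.
Qed.

End sufficiency.

End spectrum_transfer.


(** * Borel functions with values in a separable normed space *)

Section borel_functions.
Variable R : realType.

Definition borel_on (V : normedModType R[i]) (D : set R) (f : R -> V) : Prop :=
  measurable_fun D (f : R -> g_sigma_algebraType (@open V)).

Definition has_dense_seq (V : normedModType R[i]) : Prop :=
  exists e : nat -> V, forall x (r : R), 0 < r -> exists n, nrm (x - e n) < r.

Section one_space.
Variable V : normedModType R[i].
Variables (D : set R) (mD : measurable D).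

Definition nball (x : V) (r : R) : set V := [set y | nrm (x - y) < r].

Lemma nbhs_nball (x : V) (P : set V) :
  nbhs x P <-> exists2 r : R, 0 < r & nball x r `<=` P.
Proof.
split=> [/nbhs_ballP[r /= r0 rP]|[r r0 rP]].
  have rE : r = (complex.Re r)%:C by rewrite RRe_real// gtr0_real.
  exists (complex.Re r); first by rewrite -ltcR -rE.
  by move=> y xy; apply: rP; rewrite -ball_normE /= nrmE rE ltcR.
have /nrm_cvgP/(_ _ r0) : (id y @[y --> x]) --> x by [].
by apply: filterS => y; exact: rP.
Qed.

Lemma open_nball x r : open (nball x r).
Proof.
rewrite openE => y xy; apply/nbhs_nball; exists (r - nrm (x - y)).
  by rewrite subr_gt0.
move=> z yz; rewrite /nball/= (le_lt_trans (nrm_distD y _ _))//.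
by rewrite -ltrBrDl.
Qed.

Lemma borel_onP (f : R -> V) :
  borel_on D f <-> forall U, open U -> measurable (D `&` f @^-1` U).
Proof.
split=> [mf U oU|mf].
  by apply: mf => //; exact: sub_sigma_algebra.
have := @measurability _ _ _ (g_sigma_algebraType (@open V)) D f (@open V) erefl.
apply => _ [U oU <-].
exact: mf.
Qed.

Lemma continuous_borel (f : R -> V) : continuous f -> borel_on D f.
Proof.
move=> cf; apply/borel_onP => U oU; apply: measurableI => //.
by apply: open_measurable; apply: open_comp => // x _; exact: cf.
Qed.

Lemma borel_nrm (f : R -> V) : borel_on D f ->
  measurable_fun D (fun t => nrm (f t)).
Proof.
move=> /borel_onP mf; apply: (@measurability _ _ _ _ D _ (@RGenOInfty.G R)).
  exact: RGenOInfty.measurableE.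
move=> _ [_ [a ->] <-]; rewrite -[X in _ `&` X]/(f @^-1` (@nrm R V @^-1` _)).
apply: mf; apply: open_comp => [x _|]; first exact: nrm_continuous.
exact: interval_open.
Qed.

(** A pointwise limit of Borel functions is Borel: an open set is the
    increasing union of the sets of points whose ball of radius 1/m it
    contains, and these are closed. *)
Lemma borel_lim (u : nat -> R -> V) (f : R -> V) :
  (forall n, borel_on D (u n)) ->
  (forall t, D t -> u n t @[n --> \oo] --> f t) -> borel_on D f.
Proof.
move=> mu uf; apply/borel_onP => U oU.
pose C (m : nat) := [set y | nball y m.+1%:R^-1 `<=` U].
have cC m : open (~` C m).
  rewrite openE => y /existsNP[w /not_implyP[yw Uw]].
  apply/nbhs_nball; exists (m.+1%:R^-1 - nrm (y - w)); first by rewrite subr_gt0.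
  move=> z yz zC; apply: Uw; apply: zC.
  rewrite /nball/= (le_lt_trans (nrm_distD y _ _))// (nrm_distC z).
  by rewrite -ltrBrDr.
have inv0 e : 0 < e -> exists m : nat, m.+1%:R^-1 < e :> R.
  move=> e0; have /cvgrPdist_lt/(_ _ e0)[m _ H] := @cvg_harmonic R.
  exists m; have := H m (leqnn m).
  by rewrite /= sub0r normrN ger0_norm// invr_ge0.
rewrite (_ : D `&` _ = \bigcup_m \bigcup_N \bigcap_(n in [set n | (N <= n)%N])
   (D `&` u n @^-1` C m)).
  apply: bigcup_measurable => m _; apply: bigcup_measurable => N _.
  apply: bigcap_measurable; first by exists N => /=.
  move=> n _; rewrite -[C m]setCK preimage_setC.
  have /borel_onP/(_ _ (cC m)) mC := mu n.
  rewrite (_ : D `&` _ = D `\` (D `&` u n @^-1` (~` C m))).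
    exact: measurableD.
  by rewrite setDIr setDv set0U setDE.
apply/seteqP; split=> [t [Dt /= Uf]|t].
  have := oU; rewrite openE => /(_ _ Uf) /nbhs_nball[r r0 rU].
  have [m mr] := inv0 _ (divr_gt0 r0 (ltr0Sn R 1)).
  have [N _ HN] : \forall n \near \oo, nrm (f t - u n t) < r / 2.
    by have /nrm_cvgP := uf _ Dt; apply; rewrite divr_gt0.
  exists m => //; exists N => // n Nn; split=> // w /= uw; apply: rU.
  rewrite /nball/= (le_lt_trans (nrm_distD (u n t) _ _))// [ltRHS]splitr.
  by rewrite ltrD ?HN// (lt_trans uw).
move=> [m _ [N _ H]]; have [Dt _] := H N (leqnn N); split=> //.
have m0 : (0 : R) < m.+1%:R^-1 by rewrite invr_gt0 ltr0Sn.
have [n0 _ Hn0] : \forall n \near \oo, nrm (f t - u n t) < m.+1%:R^-1.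
  by have /nrm_cvgP := uf _ Dt; exact.
have [_ CN] := H (maxn N n0) (leq_maxl _ _).
by apply: CN; rewrite /nball/= nrm_distC; apply: Hn0; exact: leq_maxr.
Qed.

End one_space.

(** The preimage of an open set under op is a countable union of products of
    balls centred at the dense sequences. *)
Lemma borel_op2 (V W U : normedModType R[i]) (D : set R) (f : R -> V)
    (g : R -> W) (op : V * W -> U) : measurable D ->
  has_dense_seq V -> has_dense_seq W -> continuous op ->
  borel_on D f -> borel_on D g -> borel_on D (fun t => op (f t, g t)).
Proof.
move=> mD [a Ha] [b Hb] cop /(borel_onP mD) mf /(borel_onP mD) mg.
apply/(borel_onP mD) => O oO.
pose G (i j n : nat) := nball (a i) n.+1%:R^-1 `*` nball (b j) n.+1%:R^-1 `<=` op @^-1` O.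
rewrite (_ : D `&` _ = \bigcup_i \bigcup_j \bigcup_(n in [set n | G i j n])
   ((D `&` f @^-1` (nball (a i) n.+1%:R^-1)) `&`
    (D `&` g @^-1` (nball (b j) n.+1%:R^-1)))).
  apply: bigcup_measurable => i _; apply: bigcup_measurable => j _.
  apply: bigcup_measurable => n _.
  by apply: measurableI; [apply: mf|apply: mg]; exact: open_nball.
apply/seteqP; split=> [t [Dt /= Ot]|t]; last first.
  by move=> [i _ [j _ [n Gn [[Dt ft] [_ gt]]]]]; split=> //; exact: (Gn (f t, g t)).
have : nbhs (f t, g t) (op @^-1` O).
  by apply: cop; have := oO; rewrite openE; exact.
move=> [[P Q] /= [/nbhs_nball[r r0 rP] /nbhs_nball[q q0 qQ]] PQ].
pose d := Num.min r q; have d0 : 0 < d by rewrite lt_min r0.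
have [n nd] : exists n : nat, n.+1%:R^-1 < d / 2 :> R.
  have d2 : 0 < d / 2 by rewrite divr_gt0.
  have /cvgrPdist_lt/(_ _ d2)[m _ H] := @cvg_harmonic R.
  exists m; have := H m (leqnn m).
  by rewrite /= sub0r normrN ger0_norm// invr_ge0.
have n0 : (0 : R) < n.+1%:R^-1 by rewrite invr_gt0 ltr0Sn.
have [i fi] := Ha (f t) _ n0; have [j gj] := Hb (g t) _ n0.
exists i => //; exists j => //; exists n; last first.
  by split; split=> //=; rewrite /nball/= nrm_distC.
move=> [v w] [/= av bw]; apply: PQ; split=> /=.
  apply: rP; rewrite /nball/= (le_lt_trans (nrm_distD (a i) _ _))//.
  rewrite (@lt_le_trans _ _ d) ?ge_min ?lexx//.
  by rewrite [ltRHS]splitr ltrD// (lt_trans _ nd).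
apply: qQ; rewrite /nball/= (le_lt_trans (nrm_distD (b j) _ _))//.
rewrite (@lt_le_trans _ _ d) ?ge_min ?lexx ?orbT//.
by rewrite [ltRHS]splitr ltrD// (lt_trans _ nd).
Qed.

Lemma separable_dense_seq (V : normedModType R[i]) :
  separable_space V -> has_dense_seq V.
Proof.
move=> [E /countable_injP[g gi] dE].
exists (fun n => xget 0 [set x | E x /\ g x = n]) => x r r0.
have [y [xy Ey]] : nball x r `&` E !=set0.
  apply: dE; last exact: open_nball.
  by exists x; rewrite /nball/= subrr nrm0.
exists (g y); have [Ez gz] : [set z | E z /\ g z = g y]
    (xget 0 [set z | E z /\ g z = g y]) by apply: (@xgetPex _ 0); exists y.
by rewrite (gi _ _ _ _ gz)// inE.
Qed.

Lemma complex_dense_seq : has_dense_seq R[i]^o.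
Proof.
exists (fun n => if (unpickle n : option (rat * rat)) is Some (p, q)
   then ratr p +i* ratr q else 0) => x r r0.
have r2 : 0 < r / 2 by rewrite divr_gt0.
have near (a : R) : exists q : rat, `|a - ratr q| < r / 2.
  have [q] := @rat_in_itvoo R a (a + r / 2) ltac:(by rewrite ltrDl).
  rewrite in_itv/= => /andP[aq qa]; exists q.
  by rewrite distrC gtr0_norm ?subr_gt0// ltrBlDl.
have [p pP] := near (complex.Re x); have [q qP] := near (complex.Im x).
exists (pickle (p, q)); rewrite pickleK -[ltLHS]/(cabs _).
rewrite (le_lt_trans (cabs_le_ReIm _))// [ltRHS]splitr.
by case: x pP qP => a b /= pP qP; exact: ltrD.
Qed.

End borel_functions.

(** * Parseval's identity and the transform as a closed graph *)

Section transform.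
Variables (R : realType) (H : normedModType R[i]).
Variables (form : {dot H for Num.conj}) (hform : hilbert_form form).
Variables (hdense : has_dense_seq H) (rho : R) (rho1 : 1 < rho).
Local Notation l2n := (l2n rho).
Local Notation cp := (circle_point rho).
Local Notation period := `[0%R, (2 * pi)%R]%classic.
Implicit Types (x y : int -> H) (F G : R[i] -> H) (a b e : R) (s : seq int).

Let rho0 : 0 < rho. Proof. exact: lt_trans rho1. Qed.
Let rhoN0 : rho != 0. Proof. exact: lt0r_neq0. Qed.
Let mu := @lebesgue_measure R.
Let mperiod : measurable (period : set R). Proof. exact: measurable_itv. Qed.

Lemma cabs_cp t : cabs (cp t) = rho.
Proof. by rewrite cabs_circle_point// ltW. Qed.

Lemma cp_neq0 t : cp t != 0.
Proof.
apply/eqP => z0; have := cabs_cp t; rewrite z0 /cabs normr0 => /esym/eqP.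
by rewrite (negbTE rhoN0).
Qed.

Definition Zsum s x (z : R[i]) : H := \sum_(k <- s) z ^ (- k) *: x k.

Lemma ZpartialE x n z : Zpartial x n z = Zsum (window_seq n) x z.
Proof.
by rewrite /Zpartial /Zsum big_map -(big_mkord xpredT
  (fun j => z ^ (- (j%:Z - n%:Z)) *: x (j%:Z - n%:Z))) /index_iota subn0.
Qed.

Lemma nrm_form (x : H) : nrm x ^+ 2 = complex.Re (form x x).
Proof. by rewrite -hform nrmE -rmorphXn. Qed.

(** The square of the norm expands into the terms
    <x_k, x_l> z^(-k) conj(z^(-l)), where conj(z^(-l)) = rho^(-2l) z^l on the
    circle; only the terms k = l have a nonzero average. *)
Lemma parseval s x : uniq s ->
  mean (fun t => nrm (Zsum s x (cp t)) ^+ 2) (\sum_(k <- s) wterm rho x k).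
Proof.
move=> us.
pose d k l : R[i] := (rho ^ (- (2 * l)))%:C * form (x k) (x l).
have expand t : nrm (Zsum s x (cp t)) ^+ 2 =
    \sum_(k <- s) \sum_(l <- s) complex.Re (d k l * cp t ^ (l - k)).
  rewrite nrm_form /Zsum linear_sumlz raddf_sum; apply: eq_bigr => k _.
  rewrite linear_sumr raddf_sum; apply: eq_bigr => l _; congr complex.Re.
  rewrite linearZl_LR linearZr_LR /=.
  have cE : Num.conj (cp t ^ (- l)) = (rho ^ (- (2 * l)))%:C * cp t ^ l.
    have nz : cp t ^ (- l) != 0 by rewrite expfz_neq0// cp_neq0.
    apply: (mulfI nz); rewrite -normCK cabsE cabsXz cabs_cp.
    rewrite mulrCA -expfzDr ?cp_neq0// addNr expr0z mulr1 -rmorphXn/=.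
    by rewrite exprnP exprz_exp mulNr [l * _]mulrC.
  rewrite cE /d /= /GRing.scale/=.
  rewrite [cp t ^ (l - k)]expfzDr ?cp_neq0//; ring.
rewrite (_ : (fun _ => _) = fun t => \sum_(k <- s) \sum_(l <- s)
    complex.Re (d k l * cp t ^ (l - k))); last by apply/funext.
rewrite (_ : \sum_(k <- s) _ = \sum_(k <- s) \sum_(l <- s)
    (if l == k then wterm rho x k else 0)).
  apply: mean_sum => k; apply: mean_sum => l; case: eqP => [->|/eqP lk].
    rewrite (_ : (fun _ => _) = fun=> wterm rho x k); first exact: mean_cst.
    apply/funext => t; rewrite subrr expr0z mulr1 /d /wterm nrm_form mulrC.
    by case: (form _ _) => p q /=; ring.
  by apply: mean_circle_point; rewrite subr_eq0.
apply: eq_big_seq => k ks; rewrite (bigD1_seq k)//= eqxx big1 ?addr0//.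
by move=> l /negbTE ->.
Qed.

Lemma L2_Zsum s x : uniq s ->
  L2_sqnorm rho (Zsum s x) = (\sum_(k <- s) wterm rho x k)%:E.
Proof.
move=> us; rewrite /L2_sqnorm (parseval x us).2 -EFinM mulKf//.
by rewrite mulf_neq0// gt_eqF// pi_gt0.
Qed.

Definition circle_borel F : Prop := borel_on period (F \o cp).

Definition L2n F a : Prop :=
  [/\ 0 <= a, circle_borel F & (L2_sqnorm rho F <= (a ^+ 2)%:E)%E].

Lemma borel_scale (psi : R[i] -> R[i]) F :
  continuous (psi \o cp : R -> R[i]^o) -> circle_borel F ->
  circle_borel (fun z => psi z *: F z).
Proof.
move=> cpsi mF; apply: (@borel_op2 R R[i]^o H H period (psi \o cp) (F \o cp)
  (fun vw => vw.1 *: vw.2)) => //.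
- exact: complex_dense_seq.
- exact: scale_continuous.
- exact: continuous_borel.
Qed.

Lemma borel_add F G : circle_borel F -> circle_borel G ->
  circle_borel (fun z => F z + G z).
Proof.
move=> mF mG; apply: (@borel_op2 R H H H period (F \o cp) (G \o cp)
  (fun vw => vw.1 + vw.2)) => //.
exact: add_continuous.
Qed.

Lemma borel_comp (B : H -> H) F : continuous B -> circle_borel F ->
  circle_borel (B \o F).
Proof.
move=> cB mF; apply/(borel_onP mperiod) => U oU.
have /(borel_onP mperiod)/(_ (B @^-1` U)) := mF; apply.
by apply: open_comp => // v _; exact: cB.
Qed.

Lemma borel_sub F G : circle_borel F -> circle_borel G ->
  circle_borel (fun z => F z - G z).
Proof.
move=> mF mG; apply: borel_add => //.
by apply: (borel_comp _ mG); exact: opp_continuous.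
Qed.

Lemma continuous_cpXz (m : int) :
  continuous ((fun z => z ^ m) \o cp : R -> R[i]^o).
Proof.
rewrite (_ : _ \o _ = circle_point (rho ^ m) \o ( *%R m%:~R)).
  move=> t; apply: continuous_comp; first exact: mulrl_continuous.
  exact: continuous_circle_point.
by apply/funext => t; rewrite /= circle_pointXz circle_pointE.
Qed.

Lemma borel_Zsum s x : circle_borel (Zsum s x).
Proof.
apply: continuous_borel => // t.
apply: (@cvg_seq_sum _ _ _ _ (nbhs t) _ s (fun k u => cp u ^ (- k) *: x k)
  (fun k => cp t ^ (- k) *: x k)) => k.
by apply: cvgZl; exact: (continuous_cpXz (m := - k)).
Qed.

Let msq F : circle_borel F ->
  measurable_fun period (fun t => (nrm (F (cp t)) ^+ 2)%:E).
Proof.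
move=> mF; apply/measurable_EFinP; apply: measurable_funX.
exact: (borel_nrm mperiod mF).
Qed.

Let i2pi_ge0 : 0 <= (2 * pi)^-1 :> R.
Proof. by rewrite invr_ge0 mulr_ge0// pi_ge0. Qed.

Lemma L2_le_comb F G K (c d : R) : circle_borel F -> circle_borel G ->
  circle_borel K -> 0 <= c -> 0 <= d ->
  (forall t, nrm (F (cp t)) ^+ 2 <=
     c * nrm (G (cp t)) ^+ 2 + d * nrm (K (cp t)) ^+ 2) ->
  (L2_sqnorm rho F <= c%:E * L2_sqnorm rho G + d%:E * L2_sqnorm rho K)%E.
Proof.
move=> mF mG mK c0 d0 FGK; rewrite /L2_sqnorm !(muleCA _ (2 * pi)^-1%:E).
rewrite -ge0_muleDr//; last 2 first.
- by rewrite mule_ge0// integral_ge0// => t _; rewrite lee_fin sqr_ge0.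
- by rewrite mule_ge0// integral_ge0// => t _; rewrite lee_fin sqr_ge0.
rewrite lee_pmul2l//; last by rewrite lte_fin invr_gt0 mulr_gt0// pi_gt0.
have gG t : period t -> (0 <= (nrm (G (cp t)) ^+ 2)%:E)%E.
  by rewrite lee_fin sqr_ge0.
have gK t : period t -> (0 <= (nrm (K (cp t)) ^+ 2)%:E)%E.
  by rewrite lee_fin sqr_ge0.
rewrite -!ge0_integralZl_EFin//; try exact: msq.
rewrite -ge0_integralD//; last 4 first.
- by move=> t /gG; apply: mule_ge0.
- by apply: measurable_funeM; exact: msq.
- by move=> t /gK; apply: mule_ge0.
- by apply: measurable_funeM; exact: msq.
apply: ge0_le_integral => //.
- by move=> t _; rewrite lee_fin sqr_ge0.
- exact: msq.
- apply: emeasurable_funD; apply: measurable_funeM; exact: msq.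
by move=> t _; rewrite -!EFinM -EFinD lee_fin.
Qed.

(** The factor 2 replaces Minkowski's inequality by (X + Y)^2 <= 2 X^2 + 2 Y^2,
    which suffices for boundedness and for convergence to 0. *)
Lemma L2nD F G a b : L2n F a -> L2n G b -> L2n (fun z => F z + G z) (2 * (a + b)).
Proof.
move=> [a0 mF Fa] [b0 mG Gb]; split; first by rewrite mulr_ge0// addr_ge0.
  exact: borel_add.
have two : 0 <= 2 :> R by [].
apply: le_trans (L2_le_comb (borel_add mF mG) mF mG two two _) _.
  move=> t; have := nrmD (F (cp t)) (G (cp t)).
  set p := nrm (F _); set q := nrm (G _); set u := nrm _ => upq.
  have p0 : 0 <= p by exact: nrm_ge0.
  have q0 : 0 <= q by exact: nrm_ge0.
  have u0 : 0 <= u by exact: nrm_ge0.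
  have : u ^+ 2 <= (p + q) ^+ 2 by rewrite ler_sqr// nnegrE addr_ge0.
  by move/le_trans; apply; have := sqr_ge0 (p - q); rewrite -subr_ge0; lra.
apply: (@le_trans _ _ (2%:E * (a ^+ 2)%:E + 2%:E * (b ^+ 2)%:E)%E).
  by apply: leeD; apply: lee_wpmul2l.
by rewrite -!EFinM -EFinD lee_fin; nra.
Qed.

Lemma L2n_mul F G a C : circle_borel F -> 0 <= C ->
  (forall t, nrm (F (cp t)) <= C * nrm (G (cp t))) -> L2n G a -> L2n F (C * a).
Proof.
move=> mF C0 FG [a0 mG Ga]; split=> //; first exact: mulr_ge0.
apply: le_trans (L2_le_comb mF mG mG (sqr_ge0 C) (lexx 0) _) _.
  move=> t; rewrite mul0r addr0 -exprMn ler_sqr ?nnegrE ?mulr_ge0 ?nrm_ge0//.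
rewrite mul0e adde0 exprMn [leRHS]EFinM; apply: lee_wpmul2l => //.
by rewrite lee_fin sqr_ge0.
Qed.

Lemma L2nN F a : L2n F a -> L2n (fun z => - F z) a.
Proof.
move=> [a0 mF Fa]; rewrite -[a]mul1r; apply: (@L2n_mul _ F) => //.
  by apply: (borel_comp _ mF); exact: opp_continuous.
by move=> t; rewrite mul1r nrmN.
Qed.

Lemma L2nB F G a b : L2n F a -> L2n G b -> L2n (fun z => F z - G z) (2 * (a + b)).
Proof. by move=> Fa /L2nN; exact: L2nD. Qed.

Lemma L2n_le F a b : a <= b -> L2n F a -> L2n F b.
Proof.
move=> ab [a0 mF Fa]; split=> //; first exact: le_trans ab.
by apply: le_trans Fa _; rewrite lee_fin ler_sqr// nnegrE (le_trans a0).
Qed.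

Lemma L2n_eq F G a : (forall t, F (cp t) = G (cp t)) -> L2n F a -> L2n G a.
Proof.
move=> FG [a0 mF Fa].
have E : F \o cp = G \o cp by apply/funext.
split=> //; first by rewrite /circle_borel -E.
by move: Fa; rewrite /L2_sqnorm; under eq_integral do rewrite FG.
Qed.

Lemma L2n_Zsum s x a : uniq s -> l2n x a -> L2n (Zsum s x) a.
Proof.
move=> us [a0 xa]; split=> //; first exact: borel_Zsum.
by rewrite L2_Zsum// lee_fin xa.
Qed.

Lemma L2n_Zsum_ge s x a : uniq s -> L2n (Zsum s x) a ->
  \sum_(k <- s) wterm rho x k <= a ^+ 2.
Proof. by move=> us [_ _]; rewrite L2_Zsum// lee_fin. Qed.

Lemma L2n0 a : 0 <= a -> L2n (fun=> 0) a.
Proof.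
move=> a0; apply: (@L2n_eq (Zsum [::] (fun=> 0))).
  by move=> t; rewrite /Zsum big_nil.
by apply: L2n_Zsum => //; exact: l2n0.
Qed.

Definition supported y s : Prop := uniq s /\ forall k, k \notin s -> y k = 0.

Lemma supported_sum (f : int -> H -> H) s u y : (forall k, f k 0 = 0) ->
  supported y s -> supported y u ->
  \sum_(k <- s) f k (y k) = \sum_(k <- u) f k (y k).
Proof.
move=> f0 [us ys] [uu yu].
rewrite (bigID (mem u)) [RHS](bigID (mem s))/= addrC big1 ?add0r; last first.
  by move=> k ku; rewrite yu.
rewrite [RHS]addrC [X in _ = X + _]big1 ?add0r; last by move=> k ks; rewrite ys.
rewrite -[LHS]big_filter -[RHS]big_filter; apply: perm_big; apply: uniq_perm.
- exact: filter_uniq.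
- exact: filter_uniq.
- by move=> k; rewrite !mem_filter /= andbC.
Qed.

Lemma Zsum_supported s u y z : supported y s -> supported y u ->
  Zsum s y z = Zsum u y z.
Proof.
apply: (@supported_sum (fun k h => z ^ (- k) *: h)) => k; exact: scaler0.
Qed.

Lemma supportedS y s u : {subset s <= u} -> uniq u -> supported y s ->
  supported y u.
Proof. by move=> su uu [_ ys]; split=> // k ku; apply: ys; apply: contra ku; exact: su. Qed.

Lemma supported_union y y' s u : supported y s -> supported y' u ->
  exists w, supported y w /\ supported y' w.
Proof.
move=> ys yu; exists (undup (s ++ u)); split.
  apply: supportedS ys; last exact: undup_uniq.
  by move=> k; rewrite mem_undup mem_cat => ->.
apply: supportedS yu; last exact: undup_uniq.
by move=> k; rewrite mem_undup mem_cat => ->; rewrite orbT.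
Qed.

Lemma ZsumD s x y z : Zsum s (fun k => x k + y k) z = Zsum s x z + Zsum s y z.
Proof. by rewrite -big_split; apply: eq_bigr => k _; rewrite scalerDr. Qed.

Lemma ZsumB s x y z : Zsum s (fun k => x k - y k) z = Zsum s x z - Zsum s y z.
Proof. by rewrite -sumrB; apply: eq_bigr => k _; rewrite scalerBr. Qed.

Lemma L2n_ZsumB s u y y' a : supported y s -> supported y' u ->
  l2n (fun k => y k - y' k) a -> L2n (fun z => Zsum s y z - Zsum u y' z) a.
Proof.
move=> ys yu ya; have [w [yw yw']] := supported_union ys yu.
apply: (@L2n_eq (Zsum w (fun k => y k - y' k))); last by apply: L2n_Zsum => //; case: yw.
by move=> t; rewrite ZsumB (Zsum_supported _ ys yw) (Zsum_supported _ yu yw').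
Qed.

Lemma l2n_of_Zsum s y a : supported y s -> L2n (Zsum s y) a -> l2n y a.
Proof.
move=> ys ya; split; first by case: ya.
move=> t ut; pose w := undup (s ++ t).
have yw : supported y w.
  apply: supportedS ys; last exact: undup_uniq.
  by move=> k; rewrite mem_undup mem_cat => ->.
have := ya => /(L2n_eq (fun u => Zsum_supported (cp u) ys yw)).
move=> /L2n_Zsum_ge => /(_ yw.1); apply: le_trans.
rewrite [leRHS](bigID (mem t))/= -[leLHS]addr0 lerD//; last first.
  by apply: sumr_ge0 => k _; exact: wterm_ge0.
rewrite -[leRHS]big_filter (perm_big [seq k <- w | k \in t])//.
apply: uniq_perm => //; first by rewrite filter_uniq// undup_uniq.
by move=> k; rewrite mem_filter mem_undup mem_cat; case: (k \in t); rewrite ?orbT.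
Qed.

(** The graph of the transform, described as the closure of its restriction to
    finitely supported sequences. Unlike symmetric partial sums, this form is
    visibly stable under shifts and limits. *)
Definition Zgraph x F : Prop := circle_borel F /\
  forall e, 0 < e -> exists s y, [/\ supported y s,
    L2n (fun z => F z - Zsum s y z) e & l2n (fun k => x k - y k) e].

Lemma Zgraph_lim x F : circle_borel F ->
  (forall e, 0 < e -> exists x' F', [/\ Zgraph x' F',
    L2n (fun z => F z - F' z) e & l2n (fun k => x k - x' k) e]) ->
  Zgraph x F.
Proof.
move=> mF H'; split=> // e e0; have e4 : 0 < e / 4 by rewrite divr_gt0.
have [x' [F' [[_ gr] FF xx]]] := H' _ e4.
have [s [y [ys Fy xy]]] := gr _ e4.
exists s, y; split=> //.
  have -> : e = 2 * (e / 4 + e / 4) by field.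
  by apply: L2n_eq (L2nD FF Fy) => t; rewrite addrA subrK.
have := l2nD rho1 xx xy; under [X in l2n X]funext do rewrite addrA subrK.
apply: l2n_le => //; lra.
Qed.

Lemma Zgraph_add x y F G : Zgraph x F -> Zgraph y G ->
  Zgraph (fun k => x k + y k) (fun z => F z + G z).
Proof.
move=> [mF xF] [mG yG]; split; first exact: borel_add.
move=> e e0; have e4 : 0 < e / 4 by rewrite divr_gt0.
have [s [x' [xs Fx xx]]] := xF _ e4; have [u [y' [yu Gy yy]]] := yG _ e4.
have [w [xw yw]] := supported_union xs yu.
exists w, (fun k => x' k + y' k); split.
- by split; [exact: xw.1|move=> k kw; rewrite xw.2// yw.2// addr0].
- have -> : e = 2 * (e / 4 + e / 4) by field.
  apply: L2n_eq (L2nD Fx Gy) => t; rewrite ZsumD.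
  by rewrite (Zsum_supported _ xs xw) (Zsum_supported _ yu yw) opprD addrACA.
have := l2nD rho1 xx yy; under [X in l2n X]funext do rewrite addrACA -opprD.
apply: l2n_le => //; lra.
Qed.

Lemma Zgraph_map (B : {linear H -> H}) C x F :
  (forall h, nrm (B h) <= C * nrm h) -> Zgraph x F ->
  Zgraph (B \o x) (B \o F).
Proof.
wlog C0 : C / 0 < C.
  move=> W BC; apply: (W (`|C| + 1)); first by rewrite ltr_wpDl.
  move=> h; rewrite (le_trans (BC h))// ler_wpM2r ?nrm_ge0//.
  by rewrite (le_trans (ler_norm C))// lerDl.
move=> BC [mF xF].
have cB : continuous B.
  move=> h; apply/nrm_cvgP => e e0; have eC : 0 < e / C by rewrite divr_gt0.
  have /nrm_cvgP/(_ _ eC) : (id y @[y --> h]) --> h by [].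
  apply: filterS => g hg; rewrite -raddfB (le_lt_trans (BC _))//.
  by rewrite mulrC -ltr_pdivlMr.
have mBF : circle_borel (B \o F) by exact: borel_comp.
split=> // e e0; have eC : 0 < e / C by rewrite divr_gt0.
have [s [y [[us ys] Fy xy]]] := xF _ eC.
have eE : e = C * (e / C) by field; rewrite gt_eqF.
have ZB z : B (Zsum s y z) = Zsum s (B \o y) z.
  by rewrite /Zsum linear_sum; apply: eq_bigr => k _; rewrite linearZ.
exists s, (B \o y); split.
- by split=> // k /ys yk; rewrite /= yk raddf0.
- rewrite eE; apply: L2n_mul Fy; [|exact: ltW|].
    by apply: borel_sub => //; exact: borel_Zsum.
  by move=> t; rewrite -ZB /= -raddfB; exact: BC.
- by rewrite eE; apply: (l2n_mul rho1 (ltW C0) _ xy) => k; rewrite /= -raddfB; exact: BC.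
Qed.

Lemma Zgraph_opp x F : Zgraph x F -> Zgraph (fun k => - x k) (fun z => - F z).
Proof.
move=> xF.
have := @Zgraph_map (-%R : {linear H -> H}) 1 x F _ xF.
by apply => h; rewrite mul1r nrmN.
Qed.

Lemma Zgraph_scale (d : R[i]) x F : Zgraph x F ->
  Zgraph (fun k => d *: x k) (fun z => d *: F z).
Proof.
move=> xF.
have := @Zgraph_map ( *:%R d : {linear H -> H}) (cabs d) x F _ xF.
by apply => h; rewrite nrmZ.
Qed.

Lemma Zgraph_shift (p : int) x F : Zgraph x F ->
  Zgraph (fun k => x (k + p)) (fun z => z ^ p *: F z).
Proof.
move=> [mF xF].
have mpF : circle_borel (fun z => z ^ p *: F z).
  by apply: borel_scale => //; exact: continuous_cpXz.
split=> // e e0; have rp : 0 < rho ^ p by rewrite exprz_gt0.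
have [s [y [[us ys] Fy xy]]] := xF _ (divr_gt0 e0 rp).
have eE : e = rho ^ p * (e / rho ^ p) by field; rewrite gt_eqF.
pose s' := [seq k - p | k <- s].
have ZE t : Zsum s' (fun k => y (k + p)) (cp t) = cp t ^ p *: Zsum s y (cp t).
  rewrite /Zsum big_map scaler_sumr; apply: eq_bigr => k _.
  by rewrite subrK scalerA -expfzDr ?cp_neq0// opprB.
exists s', (fun k => y (k + p)); split.
- split; first by rewrite map_inj_uniq//; exact: addIr.
  move=> k ks; apply: ys; apply: contra ks => ks; apply/mapP.
  by exists (k + p) => //; rewrite addrK.
- rewrite eE; apply: L2n_mul Fy; [|exact: ltW|].
    by apply: borel_sub => //; exact: borel_Zsum.
  by move=> t; rewrite ZE -scalerBr nrmZ cabsXz cabs_cp.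
- by rewrite eE; apply: l2n_shift xy.
Qed.

Lemma Zgraph0 : Zgraph (fun=> 0) (fun=> 0).
Proof.
split=> [|e e0]; first by case: (L2n0 (lexx 0)).
exists [::], (fun=> 0); split=> //.
  by apply: L2n_eq (L2n0 (ltW e0)) => t; rewrite /Zsum big_nil subr0.
by under [X in l2n X]funext do rewrite subr0; apply: l2n0; rewrite ltW.
Qed.

Lemma Zgraph_sum (I : Type) (s : seq I) (x : I -> int -> H)
    (F : I -> R[i] -> H) : (forall i, Zgraph (x i) (F i)) ->
  Zgraph (fun k => \sum_(i <- s) x i k) (fun z => \sum_(i <- s) F i z).
Proof.
move=> xF; elim: s => [|i s IH].
  under eq_fun do rewrite big_nil; under [X in Zgraph _ X]eq_fun do rewrite big_nil.
  exact: Zgraph0.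
under eq_fun do rewrite big_cons; under [X in Zgraph _ X]eq_fun do rewrite big_cons.
exact: Zgraph_add.
Qed.

Lemma Zgraph_le x F a e : Zgraph x F -> 0 < e -> L2n F a -> l2n x (2 * a + e).
Proof.
move=> [_ xF] e0 Fa; have e8 : 0 < e / 8 by rewrite divr_gt0.
have [s [y [ys Fy xy]]] := xF _ e8.
have ya : l2n y (2 * (a + e / 8)).
  apply: (l2n_of_Zsum ys); apply: L2n_eq (L2nB Fa Fy) => t.
  by rewrite opprB addrCA subrr addr0.
have := l2nD rho1 xy ya; under [X in l2n X]funext do rewrite subrK.
apply: l2n_le => //; lra.
Qed.

Lemma Zgraph_ge x F a e : Zgraph x F -> 0 < e -> l2n x a -> L2n F (2 * a + e).
Proof.
move=> [_ xF] e0 xa; have e8 : 0 < e / 8 by rewrite divr_gt0.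
have [s [y [ys Fy xy]]] := xF _ e8.
have ya : l2n y (a + e / 8).
  have := l2nB rho1 xa xy; by under [X in l2n X]funext do rewrite opprB addrCA subrr addr0.
have Zy := L2n_Zsum ys.1 ya.
have := L2nD Fy Zy => /(L2n_eq (fun t => subrK _ _)); apply: L2n_le; lra.
Qed.

(** Once the symmetric partial sum contains the support of an approximation y of
    x, it differs from the transform of y by the partial sum of x - y, which is
    small by Parseval's identity. *)
Lemma is_Ztransform_of_graph x F : Zgraph x F -> is_Ztransform rho x F.
Proof.
move=> [mF xF].
have small e : 0 < e -> exists N, forall n, (N <= n)%N ->
    L2n (fun z => F z - Zpartial x n z) e.
  move=> e0; have e4 : 0 < e / 4 by rewrite divr_gt0.
  have [s [y [ys Fy xy]]] := xF _ e4.
  exists (\max_(k <- s) `|k|%N) => n Nn.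
  have yn : supported y (window_seq n).
    apply: supportedS ys; last exact: window_seq_uniq.
    by move=> k ks; rewrite mem_window_seq (leq_trans _ Nn)// (leq_bigmax_seq _ ks).
  have yx : l2n (fun k => y k - x k) (e / 4).
    by have := l2nN xy; under [X in l2n X]funext do rewrite opprB.
  have -> : e = 2 * (e / 4 + e / 4) by field.
  apply: L2n_eq (L2nD Fy (L2n_Zsum (window_seq_uniq n) yx)) => t.
  by rewrite ZpartialE ZsumB (Zsum_supported _ ys yn) addrA subrK.
have L2_ge0 G : (0 <= L2_sqnorm rho G)%E.
  by rewrite /L2_sqnorm mule_ge0// integral_ge0// => t _; rewrite lee_fin sqr_ge0.
split.
  split; first exact: mF.
  have [N /(_ _ (leqnn N)) FN] := small _ (@ltr01 R).
  have [a Za] : exists a, L2n (Zpartial x N) a.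
    have us := window_seq_uniq N.
    exists (Num.sqrt (\sum_(k <- window_seq N) wterm rho x k)).
    apply: (@L2n_eq (Zsum (window_seq N) x)); first by move=> t; rewrite ZpartialE.
    split; [exact: sqrtr_ge0|exact: borel_Zsum|].
    by rewrite L2_Zsum// sqr_sqrtr// sumr_ge0// => k _; exact: wterm_ge0.
  have [_ _ h] := L2n_eq (fun t => subrK _ _) (L2nD FN Za).
  by apply: le_lt_trans h _; rewrite ltry.
apply/fine_cvgP; split.
  have [N HN] := small _ (@ltr01 R); exists N => // n /HN[_ _ h].
  by rewrite ge0_fin_numE// (le_lt_trans h)// ltry.
apply/cvgrPdist_lt => e e0.
have e1 : 0 < Num.min e 1 by rewrite lt_min e0 ltr01.
have [N HN] := small _ (divr_gt0 e1 (ltr0Sn R 1)).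
exists N => // n /HN[_ _ h] /=; rewrite sub0r normrN ger0_norm ?fine_ge0//.
have hf : L2_sqnorm rho (fun z => F z - Zpartial x n z) \is a fin_num.
  by rewrite ge0_fin_numE// (le_lt_trans h)// ltry.
move: h; rewrite -{1}(fineK hf) lee_fin => /le_lt_trans; apply.
have m1 : Num.min e 1 <= 1 by rewrite ge_min lexx orbT.
have me : Num.min e 1 <= e by rewrite ge_min lexx.
by rewrite exprMn exprVn; nra.
Qed.

Lemma graph_of_is_Ztransform x F : ell2 rho x -> is_Ztransform rho x F ->
  Zgraph x F.
Proof.
move=> /ell2P[a xa] [[mF Foo] /fine_cvgP[fin_near cv]]; split; first exact: mF.
move=> e e0; have e2 : 0 < e ^+ 2 by rewrite exprn_gt0.
have [N1 HN1] := l2n_tail xa e0.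
have /cvgrPdist_lt/(_ _ e2)[N2 _ HN2] := cv.
have [N3 _ HN3] := fin_near.
pose N := maxn N1 (maxn N2 N3).
exists (window_seq N), (trunc N x); split.
- split; first exact: window_seq_uniq.
  by move=> k; rewrite mem_window_seq /trunc => /negbTE ->.
- have ZT z : Zsum (window_seq N) (trunc N x) z = Zpartial x N z.
    rewrite ZpartialE; apply: eq_big_seq => k; rewrite mem_window_seq /trunc.
    by move=> ->.
  apply: (@L2n_eq (fun z => F z - Zpartial x N z)) => [t|]; first by rewrite ZT.
  split; first exact: ltW.
    apply: borel_sub => //; rewrite (_ : Zpartial x N = Zsum (window_seq N) x); first exact: borel_Zsum.
    by apply/funext => z; rewrite ZpartialE.
  have /HN3 hf : (N3 <= N)%N by rewrite /N !leq_max leqnn !orbT.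
  rewrite -(fineK hf) lee_fin.
  have /HN2/= : (N2 <= N)%N by rewrite /N !leq_max leqnn !orbT.
  rewrite sub0r normrN => /ltW; apply: le_trans; exact: ler_norm.
- by apply: HN1; rewrite leq_maxl.
Qed.

Lemma graph_unique x y F : Zgraph x F -> Zgraph y F -> x = y.
Proof.
move=> xF /Zgraph_opp yF; have := Zgraph_add xF yF => G0.
apply/funext => k; apply/eqP; rewrite -subr_eq0; apply/eqP.
apply: nrm_small => e e0.
have rk : 0 < rho ^ k by rewrite exprz_gt0.
have := Zgraph_le G0 (divr_gt0 e0 rk) (a := 0) => /(_ _)/(l2n_coord rho1 k).
rewrite mulr0 add0r divfK ?gt_eqF//; apply.
by apply: L2n_eq (L2n0 (lexx 0)) => t; rewrite subrr.
Qed.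

(** * Completeness of the space of functions on the circle *)

Section riesz_fischer.
Hypothesis hH : nrm_complete H.
Variables (x : int -> H) (P : nat -> R[i] -> H).
Hypothesis mP : forall n, circle_borel (P n).
Let d n z : H := P n.+1 z - P n z.
Hypothesis dP : forall n, L2n (d n) (2 * 4 ^- n).

(** The weights 4 ^ k force the increments at z to decay like 2 ^ -k wherever the
    sum is finite, while its integral over the circle stays finite. *)
Let weight z : \bar R := (\sum_(k <oo) (4 ^+ k * nrm (d k z) ^+ 2)%:E)%E.

Let term_ge0 k z : (0 <= (4 ^+ k * nrm (d k z) ^+ 2)%:E)%E.
Proof. by rewrite lee_fin mulr_ge0 ?sqr_ge0// exprn_ge0. Qed.

Let weight_ge0 z : (0 <= weight z)%E.
Proof. by apply: nneseries_ge0 => k _ _. Qed.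

Let md n : circle_borel (d n).
Proof. exact: borel_sub. Qed.

Let mterm k :
  measurable_fun period (fun t => (4 ^+ k * nrm (d k (cp t)) ^+ 2)%:E).
Proof.
apply/measurable_EFinP; apply: measurable_funM; first exact: measurable_cst.
by apply/measurable_EFinP; exact: msq.
Qed.

Let mweight : measurable_fun period (weight \o cp).
Proof. by apply: ge0_emeasurable_sum => // k t _ _; exact: term_ge0. Qed.

Let weight_integral :
  (\int[mu]_(t in period) weight (cp t) < +oo)%E.
Proof.
rewrite integral_nneseries//.
apply: (@le_lt_trans _ _ ((2 * pi) * 4 / (1 - 2^-1))%:E); last exact: ltry.
apply: lime_le.
  by apply: is_cvg_nneseries => k _ _; apply: integral_ge0 => t _; exact: term_ge0.
apply: nearW => n.
apply: (@le_trans _ _ (\sum_(0 <= k < n) ((2 * pi) * 4 * 2^-1 ^+ k)%:E)%E).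
  apply: lee_sum => k _; under eq_integral do rewrite EFinM.
  rewrite ge0_integralZl_EFin//;
    [|by move=> t _; rewrite lee_fin sqr_ge0|exact: msq].
  have p0 : 0 < 2 * pi :> R by rewrite mulr_gt0// pi_gt0.
  have [_ _] := dP k; rewrite /L2_sqnorm lee_pdivrMl//.
  move=> /(lee_wpmul2l (_ : 0 <= (4 ^+ k)%:E)%E) => /(_ _)/le_trans; apply.
    by rewrite lee_fin exprn_ge0.
  rewrite -!EFinM lee_fin mulrCA -mulrA ler_wpM2l ?(ltW p0)//.
  have -> : 4 ^+ k * (2 * 4 ^- k) ^+ 2 = 4 * 4 ^- k :> R by field.
  by rewrite exprVn ler_wpM2l// lef_pV2 ?posrE ?exprn_gt0// lerXn2r ?nnegrE// ler_nat.
by rewrite sumEFin lee_fin -mulr_sumr ler_wpM2l ?mulr_ge0 ?pi_ge0// big_mkord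
  geo_sum_le//; lra.
Qed.

(** The value 0 where the weight is infinite, which happens on a null set, makes
    the limit measurable. *)
Definition riesz_lim z : H :=
  if (weight z < +oo)%E then lim (P^~ z @ \oo) else 0.

Let P_telescope n z : P n z = P 0%N z + series (d^~ z) n.
Proof. by rewrite /series/= telescope_sumr// addrC subrK. Qed.

Let d_geo z k : (weight z < +oo)%E ->
  nrm (d k z) <= Num.sqrt (fine (weight z)) * 2^-1 ^+ k.
Proof.
move=> zoo; have w0 := weight_ge0 z.
have fw : weight z \is a fin_num by rewrite ge0_fin_numE.
have : (4 ^+ k * nrm (d k z) ^+ 2 <= fine (weight z)).
  rewrite -lee_fin fineK//.
  apply: le_trans (nneseries_lim_ge k.+1 (fun n _ _ => term_ge0 n z)).
  by rewrite big_nat_recr//= leeDr// sume_ge0.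
rewrite -ler_pdivlMl ?exprn_gt0// => h.
rewrite -(@ler_pXn2r _ 2)// ?nnegrE ?nrm_ge0 ?mulr_ge0 ?sqrtr_ge0 ?exprn_ge0//.
rewrite (le_trans h)// exprMn sqr_sqrtr ?fine_ge0// mulrC exprAC.
by rewrite (_ : 2^-1 ^+ 2 = 4^-1) ?exprVn//; field.
Qed.

Let half01 : 0 <= (2^-1 : R) < 1. Proof. by apply/andP; split; lra. Qed.

Let P_cvg z : (weight z < +oo)%E -> P n z @[n --> \oo] --> riesz_lim z.
Proof.
move=> zoo; have [l dl] := geo_series_cvg hH half01 (fun k => d_geo k zoo).
have Pl : P n z @[n --> \oo] --> P 0%N z + l.
  under eq_fun do rewrite P_telescope.
  by apply: cvgD => //; exact: cvg_cst.
by rewrite /riesz_lim zoo (cvg_lim _ Pl)//; exact: norm_hausdorff.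
Qed.

Let P_dist z n : (weight z < +oo)%E ->
  nrm (riesz_lim z - P n z) ^+ 2 <= 4 * 4 ^- n * fine (weight z).
Proof.
move=> zoo; have w0 := weight_ge0 z.
have dl : series (d^~ z) @ \oo --> riesz_lim z - P 0%N z.
  rewrite (_ : series _ = (fun n => P n z - P 0%N z)).
    by apply: cvgB; [exact: P_cvg|exact: cvg_cst].
  by apply/funext => m; rewrite [P m z]P_telescope addrAC subrr add0r.
have := geo_series_lim n half01 (fun k => d_geo k zoo) dl.
rewrite -addrA -opprD -P_telescope => h.
apply: (@le_trans _ _ ((Num.sqrt (fine (weight z)) * 2^-1 ^+ n / (1 - 2^-1)) ^+ 2)).
  by rewrite ler_sqr// nnegrE ?nrm_ge0// (le_trans (nrm_ge0 _) h).
have h2 : (1 - 2^-1)^-1 ^+ 2 = 4 :> R by field.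
have h4 : 2^-1 ^+ 2 = 4^-1 :> R by field.
rewrite !exprMn sqr_sqrtr ?fine_ge0// exprAC h2 h4 exprVn.
by rewrite [leLHS](_ : _ = 4 * 4 ^- n * fine (weight z))//; ring.
Qed.

Lemma riesz_lim_borel : circle_borel riesz_lim.
Proof.
pose u n t := if (weight (cp t) < +oo)%E then P n (cp t) else 0.
apply: (@borel_lim _ _ _ mperiod u) => [n|t _].
  apply: (measurable_fun_if mperiod).
  - by apply: measurable_fun_lte => //; exact: measurable_cst.
  - exact: (measurable_funS mperiod (@subIsetl _ _ _) (mP n)).
  - exact: measurable_cst.
rewrite /u; have [zoo|nw] := boolP (weight (cp t) < +oo)%E; first exact: P_cvg.
by rewrite /= /riesz_lim (negbTE nw); exact: cvg_cst.
Qed.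

Lemma riesz_lim_L2 e : 0 < e -> exists N, forall n, (N <= n)%N ->
  L2n (fun z => riesz_lim z - P n z) e.
Proof.
move=> e0; set I := (\int[mu]_(t in period) weight (cp t))%E.
have I0 : (0 <= I)%E by apply: integral_ge0 => t _; exact: weight_ge0.
have fI : I \is a fin_num by rewrite ge0_fin_numE.
have q01 : 0 <= (4^-1 : R) < 1 by apply/andP; split; lra.
have [N HN] := geo_small ((2 * pi)^-1 * 4 * fine I) q01 (exprn_gt0 2 e0).
exists N => n /HN h; split; first exact: ltW.
  by apply: borel_sub => //; exact: riesz_lim_borel.
rewrite (@le_trans _ _ ((2 * pi)^-1%:E * ((4 * 4 ^- n)%:E * I))%E)//; last first.
  rewrite -(fineK fI) -!EFinM lee_fin (le_trans _ (ltW h))// exprVn.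
  by rewrite !mulrA mulrAC.
apply: lee_wpmul2l; first by rewrite lee_fin.
have c0 : 0 <= 4 * 4 ^- n :> R by rewrite mulr_ge0.
rewrite -ge0_integralZl_EFin//.
apply: ge0_le_integral => //.
- by move=> t _; rewrite lee_fin sqr_ge0.
- by apply: (@msq (fun z => riesz_lim z - P n z)); apply: borel_sub => //;
    exact: riesz_lim_borel.
- exact: measurable_funeM.
move=> t _; have w0 := weight_ge0 (cp t).
have [woo|] := boolP (weight (cp t) < +oo)%E.
  by rewrite -[weight (cp t)]fineK ?ge0_fin_numE// -EFinM lee_fin P_dist.
rewrite -leNgt leye_eq => /eqP ->.
by rewrite gt0_muley ?leey// lte_fin mulr_gt0// invr_gt0 exprn_gt0.
Qed.

End riesz_fischer.

(** Truncations with errors 4 ^ -k have transforms whose increments are small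
    enough for almost everywhere convergence. *)
Lemma Zgraph_exists x a : nrm_complete H -> l2n x a -> exists F, Zgraph x F.
Proof.
move=> hH xa.
have tails k : exists N, l2n (fun j => x j - trunc N x j) (4 ^- k).
  have k0 : 0 < 4 ^- k :> R by rewrite invr_gt0 exprn_gt0.
  by have [N HN] := l2n_tail xa k0; exists N; exact: HN.
have [nu Hnu] := choice tails.
pose y k := trunc (nu k) x; pose s k := window_seq (nu k).
have ys k : supported (y k) (s k).
  split; first exact: window_seq_uniq.
  by move=> j; rewrite mem_window_seq /y /trunc => /negbTE ->.
pose P k := Zsum (s k) (y k).
have mP k : circle_borel (P k) by exact: borel_Zsum.
have dP k : L2n (fun z => P k.+1 z - P k z) (2 * 4 ^- k).
  apply: L2n_ZsumB => //; have := l2nB rho1 (Hnu k) (Hnu k.+1).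
  under [X in l2n X]funext do rewrite opprB addrC addrA subrK.
  apply: l2n_le => //; rewrite mulr_natl mulr2n lerD2l lef_pV2 ?posrE ?exprn_gt0//.
  by rewrite exprS ler_peMl ?exprn_ge0 ?ler1n.
have hlim := riesz_lim_L2 hH mP dP.
exists (riesz_lim P); split; first exact: riesz_lim_borel.
move=> e e0; have [N1 H1] := hlim _ e0.
have q01 : 0 <= (4^-1 : R) < 1 by apply/andP; split; lra.
have [N2 H2] := geo_small 1 q01 e0.
exists (s (maxn N1 N2)), (y (maxn N1 N2)); split=> //.
  by apply: H1; exact: leq_maxl.
apply: l2n_le (Hnu (maxn N1 N2)) => //.
by have := H2 _ (leq_maxr N1 N2); rewrite mul1r exprVn => /ltW.
Qed.

End transform.

(** * The transform of a convolution *)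

Section transform_of_convolution.
Variables (R : realType) (H : completeNormedModType R[i]).
Variables (form : {dot H for Num.conj}) (hform : hilbert_form form).
Variables (hdense : has_dense_seq H) (rho : R) (rho1 : 1 < rho).
Variables (A : {linear H -> H}) (MA : R) (MA0 : 0 <= MA).
Hypothesis hA : forall x, nrm (A x) <= MA * nrm x.
Variables (c : nat -> R[i]) (c1 : forall j, cabs (c j) <= 1).
Local Notation l2n := (l2n rho).
Local Notation L2n := (L2n rho).
Local Notation Zgraph := (Zgraph rho).
Local Notation cp := (circle_point rho).
Local Notation gen := (gen c).
Local Notation conv := (conv c).
Local Notation opT := (opT A c).
Implicit Types (x y : int -> H) (F G : R[i] -> H) (a b e : R).

Let rho0 : 0 < rho. Proof. exact: lt_trans rho1. Qed.
Let r01 : 0 <= rho^-1 < 1.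
Proof. by rewrite invr_ge0 ltW//= invf_lt1. Qed.
Let r10 : 0 < 1 - rho^-1. Proof. by rewrite subr_gt0; case/andP: r01. Qed.
Let hH : nrm_complete H := @complete_nrm R H.

Lemma continuous_gen : continuous (gen \o cp : R -> R[i]^o).
Proof.
move=> t; apply/nrm_cvgP => e e0; have e3 : 0 < e / 3 by rewrite divr_gt0.
have [n /(_ _ (leqnn n)) small] := geo_small (1 - rho^-1)^-1 r01 e3.
pose S u : R[i] := \sum_(j <- index_iota 0 n) c j * cp u ^ (- j%:Z).
have tail u : cabs (gen (cp u) - S u) < e / 3.
  apply: le_lt_trans small; rewrite mulrC.
  have := gen_tail rho1 c1 n (cabs_cp rho1 u); congr (cabs (_ - _) <= _).
  by rewrite /S big_mkord; apply: eq_bigr => j _; rewrite -exprz_inv.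
have Sc : (S u : R[i]^o) @[u --> t] --> (S t : R[i]^o).
  apply: (@cvg_seq_sum _ R[i]^o) => j; apply: cvgMr.
  exact: (@continuous_cpXz R rho (- j%:Z)).
have /nrm_cvgP/(_ _ e3) := Sc; apply: filterS => u Su.
rewrite -[ltLHS]/(cabs (gen (cp t) - gen (cp u))).
apply: le_lt_trans (cabs_dist3 _ (S t) (S u) _) _.
have -> : e = e / 3 + e / 3 + e / 3 by field.
by apply: ltrD; [apply: ltrD|]; [exact: tail|exact: Su|exact: tail].
Qed.

Lemma Zgraph_conv x a F : l2n x a -> Zgraph x F ->
  Zgraph (conv x) (fun z => gen z *: F z).
Proof.
move=> xa xF; have a0 := l2n_ge0 xa.
have Fb := Zgraph_ge hform hdense rho1 xF ltr01 xa; set b := 2 * a + 1 in Fb.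
have ab : a <= b by rewrite /b; lra.
have mF := xF.1.
apply: (Zgraph_lim hdense rho1).
  by apply: borel_scale => //; exact: continuous_gen.
move=> e e0.
have [n /(_ _ (leqnn n)) small] := geo_small (b / (1 - rho^-1)) r01 e0.
have Gn : Zgraph (fun k => \sum_(j < n) c j *: x (k - j%:Z))
    (fun z => \sum_(j < n) c j *: (z ^ (- j%:Z) *: F z)).
  apply: (Zgraph_sum hform hdense rho1) => j.
  by apply: Zgraph_scale => //; exact: (Zgraph_shift hdense rho1 (- j%:Z) xF).
exists (fun k => \sum_(j < n) c j *: x (k - j%:Z)),
  (fun z => \sum_(j < n) c j *: (z ^ (- j%:Z) *: F z)); split=> //.
  apply: (@L2n_le _ _ _ _ (rho^-1 ^+ n / (1 - rho^-1) * b)).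
    by apply: le_trans (ltW small); rewrite mulrC mulrA mulrAC.
  apply: (L2n_mul _ _ _ Fb).
  - by apply: borel_sub Gn.1 => //; apply: borel_scale => //; exact: continuous_gen.
  - by rewrite mulr_ge0 ?exprn_ge0 ?invr_ge0 ?(ltW rho0)// ltW.
  move=> t; under eq_bigr do rewrite scalerA.
  rewrite -scaler_suml -scalerBl nrmZ ler_wpM2r ?nrm_ge0//.
  have := gen_tail rho1 c1 n (cabs_cp rho1 t); congr (cabs (_ - _) <= _).
  by apply: eq_bigr => j _; rewrite -exprz_inv.
apply: l2n_le (conv_tail hH rho1 c1 n xa) => //.
apply: le_trans (ltW small); rewrite mulrAC ler_wpM2r ?exprn_ge0//.
  by case/andP: r01.
by rewrite ler_wpM2r// invr_ge0 ltW.
Qed.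

Lemma Zgraph_opT x a F : l2n x a -> Zgraph x F ->
  Zgraph (opT x) (fun z => (z * gen z) *: F z - A (F z)).
Proof.
move=> xa xF; apply: (Zgraph_add hdense rho1).
  rewrite (_ : (fun z => _) = (fun z => z ^ 1 *: (gen z *: F z))).
    exact: (Zgraph_shift hdense rho1 1 (Zgraph_conv xa xF)).
  by apply/funext => z; rewrite expr1z scalerA.
by apply: (Zgraph_opp hdense rho1); exact: (Zgraph_map hdense rho1 hA xF).
Qed.

(** Pointwise lower bounds of the symbol on the circle integrate to a lower
    bound of the operator. *)
Lemma opT_bounded_below M x b : 0 <= M ->
  (forall z, cabs z = rho ->
    forall h, nrm h <= M * nrm ((z * gen z) *: h - A h)) ->
  ell2 rho x -> l2n (opT x) b -> l2n x (4 * M * b).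
Proof.
move=> M0 HM /ell2P[a xa] Tb; have b0 := l2n_ge0 Tb.
have [F xF] := Zgraph_exists hform hdense rho1 hH xa.
have TG := Zgraph_opT xa xF.
apply: l2n_addgt0 => [|e e0]; first by rewrite !mulr_ge0.
pose d := e / (2 * M + 1).
have d0 : 0 < d by rewrite divr_gt0// ltr_wpDl// mulr_ge0.
have Gb := Zgraph_ge hform hdense rho1 TG d0 Tb.
have Fb : L2n F (M * (2 * b + d)).
  apply: L2n_mul Gb => //; first exact: xF.1.
  by move=> t; apply: HM; exact: cabs_cp.
have := Zgraph_le hform hdense rho1 xF d0 Fb; apply: l2n_le => //.
have -> : 2 * (M * (2 * b + d)) + d = 4 * M * b + d * (2 * M + 1) by ring.
by rewrite /d divfK// gt_eqF// ltr_wpDl// mulr_ge0.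
Qed.

End transform_of_convolution.

(** * Fractional differences are convolutions *)

Section fractional.
Variables (R : realType) (alpha : R) (halpha : 0 < alpha < 1).

Definition frac_coef (j : nat) : R[i] := binomC alpha%:C j * (-1) ^+ j.

Lemma frac_coef0 : frac_coef 0 = 1.
Proof. by rewrite /frac_coef /binomC big_ord0 expr0 mulr1 fact0 divr1. Qed.

(** The factors of the numerator satisfy |alpha - i| <= i + 1. *)
Lemma cabs_frac_coef j : cabs (frac_coef j) <= 1.
Proof.
case/andP: halpha => a0 a1.
have cN1 : cabs (-1) = 1 :> R by rewrite /cabs normrN normr1.
rewrite /frac_coef /binomC !cabsM cabsX cN1 expr1n mulr1 cabsV.
have -> : cabs (j`!%:R : R[i]) = j`!%:R.
  by rewrite -(rmorph_nat (real_complex R)) cabs_real ger0_norm// ler0n.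
rewrite ler_pdivrMr ?ltr0n ?fact_gt0// mul1r.
elim: j => [|j IH]; first by rewrite big_ord0 fact0 cabs1.
rewrite big_ord_recr/= cabsM factS natrM mulrC ler_pM ?cabs_ge0//.
rewrite -(rmorph_nat (real_complex R)) -rmorphB/= cabs_real.
by rewrite -natr1 ler_norml; have := ler0n R j; move=> j0; apply/andP; split; lra.
Qed.

Lemma pow1p_gen z : pow1p alpha%:C (- z^-1) = gen frac_coef z.
Proof.
rewrite /pow1p /gen.
rewrite (_ : (fun k => _) = (fun k => frac_coef k * z^-1 ^+ k : R[i]^o))//.
by apply/funext => k; rewrite exprNn mulrA.
Qed.

Variables (H : completeNormedModType R[i]).
Variables (form : {dot H for Num.conj}) (hform : hilbert_form form).
Variables (hdense : has_dense_seq H) (rho : R) (rho1 : 1 < rho).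

(** The convolution has the required transform, and a sequence in the weighted
    space is determined by its transform. *)
Lemma frac_diff_conv (u : int -> H) : ell2 rho u ->
  frac_diff rho alpha%:C u = conv frac_coef u.
Proof.
move=> /[dup] ul /ell2P[a ua].
have hH := @complete_nrm R H.
have [F uF] := Zgraph_exists hform hdense rho1 hH ua.
have uZ : is_Ztransform rho u (Ztransform rho u).
  apply: (@xgetPex _ _ [set F | is_Ztransform rho u F]); exists F.
  exact: (is_Ztransform_of_graph hform hdense rho1).
have gZ := graph_of_is_Ztransform hdense ul uZ.
have gC := Zgraph_conv hform hdense rho1 cabs_frac_coef ua gZ.
rewrite /frac_diff.
under [X in Zadjoint _ X]funext do rewrite pow1p_gen.
set G := (fun z => gen _ z *: _) in gC *.
have ex : exists x, [set x | ell2 rho x /\ is_Ztransform rho x G] x.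
  exists (conv frac_coef u); split.
    exact: l2n_ell2 (conv_l2n hH rho1 cabs_frac_coef ua).
  exact: (is_Ztransform_of_graph hform hdense rho1).
have [xl xG] := @xgetPex _ (fun=> 0) _ ex.
apply: (graph_unique hform hdense rho1) gC.
exact: (graph_of_is_Ztransform hdense).
Qed.

End fractional.

(** * Invertibility and the spectrum *)

Section invertibility.
Variables (R : realType) (H : completeNormedModType R[i]).
Variables (A : {linear H -> H}) (MA : R) (MA0 : 0 <= MA).
Hypothesis hA : forall x, nrm (A x) <= MA * nrm x.

(** A perturbation by p - q costs at most half of the norm of h. *)
Lemma lower_bound_stable (p q : R[i]) M h : 0 < M ->
  nrm h <= M * nrm (p *: h - A h) -> cabs (p - q) < (2 * M)^-1 ->
  nrm h <= 2 * M * nrm (q *: h - A h).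
Proof.
move=> M0 low pq.
have E : p *: h - A h = (q *: h - A h) + (p - q) *: h.
  by rewrite scalerBl [RHS]addrC addrA subrK.
have := nrmD (q *: h - A h) ((p - q) *: h); rewrite -E nrmZ => YX.
have h0 := nrm_ge0 h.
have hh : M * (cabs (p - q) * nrm h) <= nrm h / 2.
  rewrite mulrA [leRHS]mulrC ler_wpM2r// -ler_pdivlMl// (le_trans (ltW pq))//.
  by rewrite invfM mulrC.
have : nrm h <= M * nrm (q *: h - A h) + M * (cabs (p - q) * nrm h).
  by rewrite (le_trans low)// -mulrDr ler_wpM2l// ltW.
lra.
Qed.

(** The partial sums of the Neumann series are approximate solutions. *)
Lemma resolvent_large (l : R[i]) : MA < cabs l -> resolvent_set A l.
Proof.
move=> Ml; have l0 : 0 < cabs l by exact: le_lt_trans Ml.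
have lN0 : l != 0.
  by apply/eqP => l0'; move: l0; rewrite l0' /cabs normr0 ltxx.
have d0 : 0 < cabs l - MA by rewrite subr_gt0.
apply: (@resolvent_of_approx _ _ _ _ hA l (cabs l - MA)^-1).
- by rewrite invr_gt0.
- move=> h; rewrite -ler_pdivrMl ?invr_gt0// invrK mulrBl -nrmZ lerBlDr.
  have := nrmD (l *: h - A h) (A h); rewrite subrK => /le_trans; apply.
  by rewrite lerD2l.
move=> h e e0.
have q01 : 0 <= MA / cabs l < 1.
  by rewrite divr_ge0 ?cabs_ge0//= ltr_pdivrMr// mul1r.
have [n /(_ _ (leqnn n)) small] := geo_small (nrm h) q01 e0.
exists (\sum_(i < n) l ^- i.+1 *: iter i A h).
have -> : l *: (\sum_(i < n) l ^- i.+1 *: iter i A h) -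
    A (\sum_(i < n) l ^- i.+1 *: iter i A h) - h = - (l ^- n *: iter n A h).
  elim: {small} n => [|n IH].
    by rewrite !big_ord0 scaler0 raddf0 subrr sub0r expr0 invr1 scale1r.
  rewrite !big_ord_recr/= scalerDr raddfD/= opprD addrACA [LHS]addrAC IH.
  have -> : A (l ^- n.+1 *: iter n A h) = l ^- n.+1 *: A (iter n A h).
    by rewrite linearZ.
  by rewrite scalerA exprS invfM mulVKf// addrA addNr sub0r.
rewrite nrmN nrmZ cabsV cabsX (le_trans _ (ltW small))//.
have it : nrm (iter n A h) <= MA ^+ n * nrm h.
  elim: {small} n => [|n IH]; first by rewrite expr0 mul1r.
  by rewrite iterS (le_trans (hA _))// exprS -mulrA ler_wpM2l.
rewrite exprMn exprVn mulrC mulrA ler_wpM2r ?invr_ge0 ?exprn_ge0 ?cabs_ge0//.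
by rewrite mulrC.
Qed.

Variables (c : nat -> R[i]) (c1 : forall j, cabs (c j) <= 1).
Local Notation gen := (gen c).

(** The constant term of gen is 1 and the remaining terms add up to at most
    1 / (|z| - 1) <= 1 / 2. *)
Lemma symbol_large z : c 0%N = 1 -> 3 + 2 * MA < cabs z ->
  resolvent_set A (z * gen z).
Proof.
move=> c0 zM; apply: resolvent_large.
have M0 := MA0.
have z3 : 3 < cabs z by apply: le_lt_trans zM; rewrite lerDl mulr_ge0.
have z1 : 1 < cabs z by lra.
have z0 : 0 < cabs z by lra.
have := gen_tail z1 c1 1 erefl.
rewrite big_ord1 expr0 mulr1 c0 expr1 => tail.
have h1 : (cabs z)^-1 / (1 - (cabs z)^-1) = (cabs z - 1)^-1.
  by field; rewrite (gt_eqF z0) subr_eq0 (gt_eqF z1).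
have h2 : (cabs z - 1)^-1 <= 2^-1.
  by rewrite lef_pV2 ?posrE//; lra.
have h3 : 1 <= cabs (gen z) + cabs (gen z - 1).
  have := @nrmB R R[i]^o (gen z) (gen z - 1).
  by rewrite opprB addrCA subrr addr0 -[X in X <= _]/(cabs 1) cabs1.
have h4 : 2^-1 <= cabs (gen z) by rewrite h1 in tail; lra.
rewrite cabsM; nra.
Qed.

Variables (rho : R) (rho1 : 1 < rho).
Local Notation cp := (circle_point rho).
Local Notation l2n := (l2n rho).

Let rho0 : 0 < rho. Proof. exact: lt_trans rho1. Qed.

(** The resolvent is locally bounded, hence bounded on the compact image of the
    circle. *)
Lemma uniform_lower_bound :
  (forall z, cabs z = rho -> resolvent_set A (z * gen z)) ->
  exists2 M, 0 < M & forall z, cabs z = rho ->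
    forall h, nrm h <= M * nrm ((z * gen z) *: h - A h).
Proof.
move=> res.
pose P (M t : R) := forall h, nrm h <= M * nrm ((cp t * gen (cp t)) *: h - A h).
have cf : continuous ((fun z => z * gen z) \o cp : R -> R[i]^o).
  move=> t; apply: (@cvgM R[i] R (nbhs t)).
    exact: continuous_circle_point.
  exact: continuous_gen.
have near_cov : near_covering (`[0, 2 * pi]%classic : set R).
  by apply/compact_near_coveringP; exact: segment_compact.
have [] := near_cov R +oo (fun M t => P M t) _.
  move=> t _; have [_ [S [_ ST _ [M0 SM]]]] := res _ (cabs_cp rho1 t).
  pose M := `|M0| + 1; have M1 : 0 < M by rewrite ltr_wpDl.
  have low h : nrm h <= M * nrm ((cp t * gen (cp t)) *: h - A h).
    rewrite -{1}(ST h I) (le_trans (SM _ I))// ler_wpM2r ?nrm_ge0//.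
    by rewrite (le_trans (ler_norm M0))// lerDl.
  have M20 : 0 < (2 * M)^-1 by rewrite invr_gt0 mulr_gt0.
  have /nrm_cvgP/(_ _ M20) := cf t => ns.
  exists ([set s | cabs (cp t * gen (cp t) - cp s * gen (cp s)) < (2 * M)^-1],
    [set M' | 2 * M < M']).
    by split=> //=; apply: nbhs_pinfty_gt; rewrite num_real.
  move=> [s M'] /= [ss MM'] h.
  apply: le_trans (lower_bound_stable M1 (low h) ss) _.
  by rewrite ler_wpM2r ?nrm_ge0// ltW.
move=> M0 [_ HM]; exists (`|M0| + 1); first by rewrite ltr_wpDl.
move=> z zr h; have [t tI <-] := circle_pointP rho0 zr.
apply: (HM (`|M0| + 1) _ t tI).
by rewrite (le_lt_trans (ler_norm M0))// ltrDl.
Qed.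

Variables (form : {dot H for Num.conj}) (hform : hilbert_form form).
Hypothesis hdense : has_dense_seq H.

Lemma invertible_of_resolvent :
  (forall z, cabs z = rho -> resolvent_set A (z * gen z)) ->
  invertible_on (@ell2 R H rho) (@ell2_norm R H rho) (opT A c).
Proof.
move=> res; have [M M0 HM] := uniform_lower_bound res.
have hH := @complete_nrm R H.
have l2 (x : int -> H) : ell2 rho x -> l2n x (ell2_norm rho x) by exact: l2n_norm.
have solve z : cabs z = rho -> forall h, exists2 g,
    (z * gen z) *: g - A g = h & nrm g <= M * nrm h.
  move=> zr h; have [_ [S [_ _ TS _]]] := res _ zr.
  by exists (S h); [exact: TS|rewrite -{2}(TS h I); exact: HM].
have sym (x y : int -> H) : ell2_norm rho (x - y) = ell2_norm rho (y - x).
  rewrite /ell2_norm /ell2_sqnorm; congr (Num.sqrt (fine _)).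
  by apply: eq_esum => k _; rewrite -nrmN opprB.
apply: (@invertible_of_approx R (int -> H) (@ell2 R H rho) (@ell2_norm R H rho)
  (opT A c) (rho / (1 - rho^-1) + MA) (4 * M)).
- by move=> x y /l2 xa /l2 yb; exact: l2n_ell2 (l2nB rho1 xa yb).
- exact: l2n_ell2 (l2n0 rho H (lexx 0)).
- apply/eqP; rewrite eq_le ell2_norm_ge0 andbT; apply: ell2_norm_le.
  exact: (l2n0 rho H (lexx 0)).
- by move=> x; exact: ell2_norm_ge0.
- move=> x /l2 xa x0; apply/funext => k; apply: nrm_eq0; apply/eqP.
  rewrite eq_le nrm_ge0 andbT (le_trans (l2n_coord rho1 k xa))//.
  by rewrite mulr_le0_ge0// exprz_ge0 ?ltW.
- exact: sym.
- move=> x y z /l2 xa /l2 yb /l2 zc; apply: ell2_norm_le.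
  have Dxy := l2n_norm (l2n_ell2 (l2nB rho1 xa yb)).
  have Dyz := l2n_norm (l2n_ell2 (l2nB rho1 yb zc)).
  have := l2nD rho1 Dxy Dyz; under [X in l2n X]funext do rewrite addrA subrK.
  exact.
- move=> u uD uC; have [e e0|x Hx] := l2n_complete rho1 (u := u) hH.
    have [N HN] := uC _ e0; exists N => n m Nn Nm.
    apply: l2n_le (HN _ _ Nn Nm) _ => //.
    exact: l2n_norm (l2n_ell2 (l2nB rho1 (l2 _ (uD n)) (l2 _ (uD m)))).
  exists x.
    have [N /(_ _ (leqnn N)) Hn] := Hx _ (@ltr01 R).
    have := l2nB rho1 (l2 _ (uD N)) Hn.
    by under [X in l2n X]funext do rewrite opprB addrCA subrr addr0; exact: l2n_ell2.
  by move=> e /Hx[N HN]; exists N => n /HN; exact: ell2_norm_le.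
- by move=> x /l2 xa; exact: l2n_ell2 (l2n_opT MA0 hA rho1 c1 xa).
- by move=> x y /l2 xa /l2 yb; rewrite (opTB A rho1 c1 xa yb).
- by move=> x /l2 xa; exact: ell2_norm_le (l2n_opT MA0 hA rho1 c1 xa).
- by rewrite mulr_gt0.
- move=> x xD; apply: ell2_norm_le.
  have Tx := l2n_norm (l2n_ell2 (l2n_opT MA0 hA rho1 c1 (l2 _ xD))).
  exact: (opT_bounded_below hform hdense rho1 hA c1 (ltW M0) HM xD Tx).
- move=> y e /l2 ya e0.
  have [x [a xa] Hx] := dense_range MA0 hA rho1 c1 M0 solve ya e0.
  by exists x; [exact: l2n_ell2 xa|exact: ell2_norm_le Hx].
Qed.

End invertibility.

Lemma eq_invertible_on (R : realType) (V : Type) (D : set V) (N : V -> R)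
    (T T' : V -> V) : (forall x, D x -> T x = T' x) ->
  invertible_on D N T -> invertible_on D N T'.
Proof.
move=> TT [TD [S [SD ST TS SM]]].
split; first by move=> x Dx; rewrite -TT//; exact: TD.
exists S; split=> // [x Dx|y Dy]; first by rewrite -TT// ST.
by rewrite -TT; [exact: TS|exact: SD].
Qed.

Theorem lemma4p5 (R : realType) (H : completeNormedModType R[i])
    (form : {dot H for Num.conj}) (hform : hilbert_form form)
    (hsep : separable_space H)
    (A : {linear H -> H}) (hA : bounded_operator A)
    (alpha : R) (halpha : 0 < alpha < 1) :
  (forall rho : R, 1 < rho ->
     invertible_on (@ell2 R H rho) (@ell2_norm R H rho)
       (fun u k => tau (frac_diff rho alpha%:C u) k - A (u k))
     <-> (symb alpha%:C @` circle rho) `&` spectrum A = set0)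
  /\
  (exists2 rho : R, 1 < rho &
     (forall mu : R, rho < mu ->
        (symb alpha%:C @` circle mu) `&` spectrum A = set0)
     /\ symb alpha%:C @` [set z | rho%:C < `|z|] `<=` resolvent_set A).
Proof.
have hdense := separable_dense_seq hsep.
have [MA MA0 MAb] : exists2 MA, 0 <= MA & forall x, nrm (A x) <= MA * nrm x.
  have [M HM] := hA; exists `|M| => // x.
  by rewrite (le_trans (HM x))// ler_wpM2r ?nrm_ge0// ler_norm.
have c1 := cabs_frac_coef halpha.
have symbE z : symb alpha%:C z = z * gen (frac_coef alpha) z.
  by rewrite /symb pow1p_gen.
have circleE rho z : circle rho z <-> cabs z = rho.
  by rewrite /circle /= cabsE; split=> [/complexI|->].
have disjointE rho : (symb alpha%:C @` circle rho) `&` spectrum A = set0 <->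
    forall z, cabs z = rho -> resolvent_set A (z * gen (frac_coef alpha) z).
  split=> [E z zr|res].
    have zc : circle rho z by apply/circleE.
    apply: contrapT => nres.
    suff : ((symb alpha%:C @` circle rho) `&` spectrum A) (symb alpha%:C z).
      by rewrite E.
    split; first exact: imageP.
    by rewrite /spectrum /= symbE.
  by rewrite -subset0 => _ [[z /circleE zr <-]]; rewrite symbE => /(_ (res z zr)).
split=> [rho rho1|].
  have opE u : ell2 rho u -> opT A (frac_coef alpha) u =
      (fun k => tau (frac_diff rho alpha%:C u) k - A (u k)).
    by move=> ul; rewrite (frac_diff_conv halpha hform hdense rho1 ul).
  rewrite disjointE; split=> [inv z zr|res].
    apply: (resolvent_of_invertible MAb rho1 c1 _ zr).
    by apply: eq_invertible_on inv => u ul; rewrite opE.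
  apply: (eq_invertible_on opE).
  exact: (invertible_of_resolvent MA0 MAb c1 rho1 hform hdense res).
exists (3 + 2 * MA); first lra.
split=> [mu hmu|_ [z zM <-]].
  by apply/disjointE => z zmu; apply: (symbol_large MA0 MAb c1); rewrite ?frac_coef0 ?zmu.
rewrite symbE; apply: (symbol_large MA0 MAb c1); rewrite ?frac_coef0//.
by move: zM => /=; rewrite cabsE ltcR.
Qed.
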